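(* Let $(M,\varphi_i,\xi_i,\eta_i,g)$, $i=1,2,3$, be an almost $3$-contact metric manifold. Then $M$ admits a metric connection $\nabla$ with skew torsion such that, for some smooth function $\tilde\beta\in C^\infty(M)$, $$\nabla_X\varphi_i=\tilde\beta\,(\eta_k(X)\varphi_j-\eta_j(X)\varphi_k)\qquad\text{for all vector fields }X$$ and for every even permutation $(i,j,k)$ of $(1,2,3)$, if and only if $M$ is a canonical almost $3$-contact metric manifold. If such a connection $\nabla$ exists, it is unique, it is $\varphi$-compatible for every almost contact metric structure $\varphi$ in the associated sphere $\Sigma_M$, and $\tilde\beta$ coincides with the Reeb Killing function $\beta$. Its torsion $T$ satisfies, for all $X,Y,Z\in\Gamma(\mathcal H)$, all $i,j=1,2,3$ and every $\varphi\in\Sigma_M$ (with fundamental form $\Phi$), $$T(X,Y,Z)=N_\varphi(X,Y,Z)-d\Phi(\varphi X,\varphi Y,\varphi Z),\quad T(X,Y,\xi_i)=d\eta_i(X,Y),\quad T(X,\xi_i,\xi_j)=-g([\xi_i,\xi_j],X),$$ and the parameter function is $\gamma:=T(\xi_1,\xi_2,\xi_3)=2(\beta-\delta)$, where $\delta$ is the Reeb commutator function.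
   Context: An almost contact metric structure $(\varphi,\xi,\eta,g)$ consists of a $(1,1)$-tensor field $\varphi$, a vector field $\xi$, a $1$-form $\eta$ and a Riemannian metric $g$ with $\varphi^2=-I+\eta\otimes\xi$, $\eta(\xi)=1$, $g(\varphi X,\varphi Y)=g(X,Y)-\eta(X)\eta(Y)$. Its fundamental form is $\Phi(X,Y)=g(X,\varphi Y)$, and $N_\varphi(X,Y)=[\varphi X,\varphi Y]+\varphi^2[X,Y]-\varphi[\varphi X,Y]-\varphi[X,\varphi Y]+d\eta(X,Y)\xi$, $N_\varphi(X,Y,Z)=g(N_\varphi(X,Y),Z)$. An almost $3$-contact metric manifold $(M,\varphi_i,\xi_i,\eta_i,g)$, $i=1,2,3$, is a manifold of dimension $4n+3$ with three almost contact metric structures with the same $g$ such that, for every even permutation $(i,j,k)$ of $(1,2,3)$, $\varphi_k=\varphi_i\varphi_j-\eta_j\otimes\xi_i=-\varphi_j\varphi_i+\eta_i\otimes\xi_j$, $\xi_k=\varphi_i\xi_j=-\varphi_j\xi_i$, $\eta_k=\eta_i\circ\varphi_j=-\eta_j\circ\varphi_i$. The fundamental form of the $i$-th structure is denoted $\Phi_i$. Set $\mathcal H=\bigcap_i\ker\eta_i$, $\mathcal V=\langle\xi_1,\xi_2,\xi_3\rangle$, so $TM=\mathcal H\oplus\mathcal V$. The associated sphere $\Sigma_M$ consists of all almost contact metric structures $\varphi_a=\sum a_i\varphi_i$, $\xi_a=\sum a_i\xi_i$, $\eta_a=\sum a_i\eta_i$ with $a=(a_1,a_2,a_3)\in S^2$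 (and metric $g$). For $X,Y\in\Gamma(\mathcal H)$ let $A_{ij}(X,Y)=g((\mathcal L_{\xi_j}\varphi_i)X,Y)+d\eta_j(X,\varphi_iY)+d\eta_j(\varphi_iX,Y)$, $A_i=A_{ii}$. $M$ admits a Reeb Killing function $\beta\in C^\infty(M)$ if $A_i(X,Y)=0$ and $A_{ij}(X,Y)=-A_{ji}(X,Y)=\beta\Phi_k(X,Y)$ for all $X,Y\in\Gamma(\mathcal H)$ and every even permutation $(i,j,k)$ of $(1,2,3)$. $M$ is canonical if: 1) each $N_{\varphi_i}$ is skew-symmetric on $\mathcal H$ (i.e. $N_{\varphi_i}(X,Y,Z)$ restricted to $\mathcal H$ is a $3$-form); 2) each $\xi_i$ is Killing; 3) $N_{\varphi_i}(X,Y,Z)-d\Phi_i(\varphi_iX,\varphi_iY,\varphi_iZ)=N_{\varphi_j}(X,Y,Z)-d\Phi_j(\varphi_jX,\varphi_jY,\varphi_jZ)$ for all $X,Y,Z\in\Gamma(\mathcal H)$ and all $i,j$; 4) $M$ admits a Reeb Killing function $\beta$. The Reeb commutator function is the function $\delta\in C^\infty(M)$ with $\eta_k([\xi_i,\xi_j])=2\delta\epsilon_{ijk}$ for all $i,j,k$ ($\epsilon_{ijk}$ the totally skew symbol); it exists whenever all $\xi_i$ are Killing. A metric connection $\nabla$ has skew torsion if $T(X,Y,Z)=g(T(X,Y),Z)$ is a $3$-form; then $\nabla_XY=\nabla^g_XY+\frac12T(X,Y)$, with $\nabla^g$ the Levi-Civita connection. For $\varphi\in\Sigma_M$, a $\varphi$-compatible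 connection is a metric connection with skew torsion that preserves the splitting $TM=\mathcal H\oplus\mathcal V$ and satisfies $(\nabla_X\varphi)Y=0$ for all $X,Y\in\Gamma(\mathcal H)$; its parameter function is $T(\xi_1,\xi_2,\xi_3)$. Conventions: $d\eta(X,Y)=X(\eta(Y))-Y(\eta(X))-\eta([X,Y])$, and analogously (no numerical factors) for forms of higher degree.
   Formalization: Uniqueness of the connection and of the Reeb Killing function are claimed only for dimension 4n+3 with n ≥ 1; in dimension 3 (e.g. SU(2)) H = 0 and every smooth function β̃ gives such a connection, so uniqueness fails. *)

(* Defs.v *)
From HB Require Import structures.
From mathcomp Require Import all_boot all_order all_algebra all_fingroup.
From mathcomp Require Import mathcomp_extra boolp classical_sets functions.
From mathcomp Require Import reals topology normedtype derive.
From mathcomp Require Import ring.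

Set Implicit Arguments.
Unset Strict Implicit.
Unset Printing Implicit Defensive.

Import Order.TTheory GRing.Theory Num.Theory.
Import numFieldNormedType.Exports.

Local Open Scope classical_set_scope.
Local Open Scope ring_scope.

Section SmoothOnOpen.
Variables (R : realType) (m : nat).
Implicit Types (U : set 'rV[R]_m) (f g : 'rV[R]_m -> R).

(* C^k on an open set U: all iterated partial derivatives of order <= k exist
   and are continuous on U. The values of f outside U are irrelevant since U is
   always open where this is used. *)
Fixpoint Ck (k : nat) U f : Prop :=
  (forall x, U x -> {for x, continuous f}) /\
  if k is k'.+1 then
    forall i : 'I_m,
      (forall x, U x -> derivable f x 'e_i) /\
      Ck k' U (fun x => 'D_('e_i) f x)
  else True.

Definition smooth_on U f : Prop := forall k, Ck k U f.

Lemma CkW k U f : Ck k.+1 U f -> Ck k U f.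
Proof.
elim: k f => [|k IH] f [cf Df]; split=> // i.
have [df cdf] := Df i; split=> //; exact: IH.
Qed.

Lemma Ck_eq k U f g : open U -> (forall x, U x -> f x = g x) ->
  Ck k U f -> Ck k U g.
Proof.
move=> oU; elim: k f g => [|k IH] f g fg [cf Df]; split=> //.
1,2: move=> x Ux; have fgx : {near nbhs x, f =1 g}
       by apply: filterS (open_nbhs_nbhs (conj oU Ux)) => y /fg.
1,2: rewrite /prop_for /continuous_at -(fg x Ux).
1,2: exact: cvg_trans (near_eq_cvg fgx) (cf x Ux).
move=> i; have [df cdf] := Df i.
have fgx x : U x -> {near nbhs x, f =1 g}.
  by move=> Ux; apply: filterS (open_nbhs_nbhs (conj oU Ux)) => y /fg.
split=> [x Ux|].
  exact: near_eq_derivable (fgx x Ux) (df x Ux).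
apply: (IH ('D_('e_i) f)) cdf => x /fgx fgx'; exact: near_eq_derive.
Qed.

Lemma Ck_cst k U (c : R) : Ck k U (fun=> c).
Proof.
elim: k c => [|k IH] c; split=> //.
1,2: by move=> x _; exact: cst_continuous.
move=> i; split=> [x _|]; first exact: derivable_cst.
have -> : 'D_('e_i) (fun=> c) = (fun=> 0) :> ('rV[R]_m -> R).
  by apply/funext => x; rewrite derive_cst.
exact: IH.
Qed.

Lemma CkD k U f g : open U -> Ck k U f -> Ck k U g ->
  Ck k U (fun x => f x + g x).
Proof.
move=> oU; elim: k f g => [|k IH] f g [cf Df] [cg Dg]; split=> //.
1,2: by move=> x Ux; exact: cvgD (cf x Ux) (cg x Ux).
move=> i; have [df cdf] := Df i; have [dg cdg] := Dg i; split=> [x Ux|].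
  by apply: derivableD; [exact: df|exact: dg].
apply: (Ck_eq oU _ (IH _ _ cdf cdg)) => x Ux.
by rewrite -deriveD//; [exact: df|exact: dg].
Qed.

Lemma CkM k U f g : open U -> Ck k U f -> Ck k U g ->
  Ck k U (fun x => f x * g x).
Proof.
move=> oU; elim: k f g => [|k IH] f g cf cg.
  by split=> // x Ux; exact: cvgM (cf.1 x Ux) (cg.1 x Ux).
split=> [x Ux|i]; first exact: cvgM (cf.1 x Ux) (cg.1 x Ux).
have [df cdf] := cf.2 i; have [dg cdg] := cg.2 i; split=> [x Ux|].
  by apply: derivableM; [exact: df|exact: dg].
have := CkD oU (IH _ _ (CkW cf) cdg) (IH _ _ (CkW cg) cdf).
apply: (Ck_eq oU) => x Ux.
by rewrite [RHS]deriveM//; [exact: df|exact: dg].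
Qed.

End SmoothOnOpen.

Record chart (R : realType) (M : topologicalType) (m : nat) := Chart {
  chart_dom : set M ;
  chart_img : set 'rV[R]_m ;
  chart_map : M -> 'rV[R]_m ;
  chart_inv : 'rV[R]_m -> M ;
  chart_dom_open : open chart_dom ;
  chart_img_open : open chart_img ;
  chart_map_img : forall p, chart_dom p -> chart_img (chart_map p) ;
  chart_inv_dom : forall x, chart_img x -> chart_dom (chart_inv x) ;
  chart_mapK : forall p, chart_dom p -> chart_inv (chart_map p) = p ;
  chart_invK : forall x, chart_img x -> chart_map (chart_inv x) = x ;
  chart_map_cont : forall p, chart_dom p -> {for p, continuous chart_map} ;
  chart_inv_cont : forall x, chart_img x -> {for x, continuous chart_inv}
}.

Definition compatible_charts (R : realType) (M : topologicalType) (m : nat)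
    (c c' : chart R M m) : Prop :=
  forall i : 'I_m,
    smooth_on (chart_img c `&` chart_inv c @^-1` chart_dom c')
              (fun x => chart_map c' (chart_inv c x) 0 i).

Record manifold (R : realType) (m : nat) := Manifold {
  carrier :> topologicalType ;
  manifold_hausdorff : hausdorff_space carrier ;
  manifold_second_countable : @second_countable carrier ;
  atlas : set (chart R carrier m) ;
  atlas_cover : forall p : carrier, exists2 c, atlas c & chart_dom c p ;
  atlas_compatible :
    forall c c', atlas c -> atlas c' -> compatible_charts c c'
}.

Section SmoothFunctions.
Variables (R : realType) (m : nat) (M : manifold R m).

Definition smooth (f : M -> R) : Prop :=
  forall c : chart R M m, atlas c -> smooth_on (chart_img c) (f \o chart_inv c).

Record smoothFun := SmoothFun { sf_fun :> M -> R ; sf_smooth : smooth sf_fun }.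

HB.instance Definition _ := gen_eqMixin smoothFun.
HB.instance Definition _ := gen_choiceMixin smoothFun.

Implicit Types f g h : smoothFun.

Lemma sfP f g : (forall p, f p = g p) -> f = g.
Proof.
case: f g => [f sf] [g sg] /= /funext fg; rewrite fg in sf *.
by congr SmoothFun; exact: Prop_irrelevance.
Qed.

Lemma sf_cst_smooth (a : R) : smooth (fun=> a).
Proof. by move=> c _ k; exact: Ck_cst. Qed.

Lemma sf_add_smooth f g : smooth (fun p => f p + g p).
Proof.
by move=> c Ac k; apply: CkD; [exact: chart_img_open|exact: sf_smooth..].
Qed.

Lemma sf_mul_smooth f g : smooth (fun p => f p * g p).
Proof.
by move=> c Ac k; apply: CkM; [exact: chart_img_open|exact: sf_smooth..].
Qed.

Lemma sf_scale_smooth (a : R) f : smooth (fun p => a * f p).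
Proof. exact: (sf_mul_smooth (SmoothFun (sf_cst_smooth a)) f). Qed.

Lemma sf_opp_smooth f : smooth (fun p => - f p).
Proof.
rewrite (_ : (fun p => _) = fun p => -1 * f p); first exact: sf_scale_smooth.
by apply/funext => p; rewrite mulN1r.
Qed.

Definition sf_cst a := SmoothFun (sf_cst_smooth a).
Definition sf_add f g := SmoothFun (sf_add_smooth f g).
Definition sf_mul f g := SmoothFun (sf_mul_smooth f g).
Definition sf_opp f := SmoothFun (sf_opp_smooth f).
Definition sf_scale a f := SmoothFun (sf_scale_smooth a f).

Lemma sf_addA : associative sf_add.
Proof. by move=> f g h; apply: sfP => p /=; rewrite addrA. Qed.
Lemma sf_addC : commutative sf_add.
Proof. by move=> f g; apply: sfP => p /=; rewrite addrC. Qed.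
Lemma sf_add0 : left_id (sf_cst 0) sf_add.
Proof. by move=> f; apply: sfP => p /=; rewrite add0r. Qed.
Lemma sf_addN : left_inverse (sf_cst 0) sf_opp sf_add.
Proof. by move=> f; apply: sfP => p /=; rewrite addNr. Qed.

HB.instance Definition _ :=
  GRing.isZmodule.Build smoothFun sf_addA sf_addC sf_add0 sf_addN.

Lemma sf_mulA : associative sf_mul.
Proof. by move=> f g h; apply: sfP => p /=; rewrite mulrA. Qed.
Lemma sf_mulC : commutative sf_mul.
Proof. by move=> f g; apply: sfP => p /=; rewrite mulrC. Qed.
Lemma sf_mul1 : left_id (sf_cst 1) sf_mul.
Proof. by move=> f; apply: sfP => p /=; rewrite mul1r. Qed.
Lemma sf_mulDl : left_distributive sf_mul sf_add.
Proof. by move=> f g h; apply: sfP => p /=; rewrite mulrDl. Qed.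

HB.instance Definition _ :=
  GRing.Zmodule_isComPzRing.Build smoothFun sf_mulA sf_mulC sf_mul1 sf_mulDl.

Lemma sf_scaleA a b f : sf_scale a (sf_scale b f) = sf_scale (a * b) f.
Proof. by apply: sfP => p /=; rewrite mulrA. Qed.
Lemma sf_scale1 : left_id 1 sf_scale.
Proof. by move=> f; apply: sfP => p /=; rewrite mul1r. Qed.
Lemma sf_scaleDr : right_distributive sf_scale +%R.
Proof. by move=> a f g; apply: sfP => p /=; rewrite mulrDr. Qed.
Lemma sf_scaleDl f : {morph sf_scale^~ f : a b / a + b}.
Proof. by move=> a b; apply: sfP => p /=; rewrite mulrDl. Qed.

HB.instance Definition _ := GRing.Zmodule_isLmodule.Build R smoothFun
  sf_scaleA sf_scale1 sf_scaleDr sf_scaleDl.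

Lemma sfDE f g p : (f + g) p = f p + g p. Proof. by []. Qed.
Lemma sfNE f p : (- f) p = - f p. Proof. by []. Qed.
Lemma sfME f g p : (f * g) p = f p * g p. Proof. by []. Qed.
Lemma sfZE a f p : (a *: f) p = a * f p. Proof. by []. Qed.
Lemma sf0E p : (0 : smoothFun) p = 0. Proof. by []. Qed.
Lemma sf1E p : (1 : smoothFun) p = 1. Proof. by []. Qed.

Lemma sf_scaleAl (a : R) f g : a *: (f * g) = (a *: f) * g.
Proof. by apply: sfP => p /=; rewrite mulrA. Qed.
Lemma sf_scaleAr (a : R) f g : a *: (f * g) = f * (a *: g).
Proof. by rewrite mulrC sf_scaleAl mulrC. Qed.

(* Vector fields are identified with the R-linear derivations of C^oo(M); the
   Lie bracket is then the commutator. *)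
Record vectorField := VectorField {
  vf_fun :> smoothFun -> smoothFun ;
  vf_linear : linear vf_fun ;
  vf_leibniz : forall f g, vf_fun (f * g) = vf_fun f * g + f * vf_fun g
}.

HB.instance Definition _ (X : vectorField) :=
  GRing.isLinear.Build R smoothFun smoothFun *:%R X (vf_linear X).

Lemma vfD (X : vectorField) f g : X (f + g) = X f + X g.
Proof. exact: linearD. Qed.

HB.instance Definition _ := gen_eqMixin vectorField.
HB.instance Definition _ := gen_choiceMixin vectorField.

Implicit Types X Y Z : vectorField.

Lemma vfP X Y : (forall f, X f = Y f) -> X = Y.
Proof.
case: X Y => [X lX dX] [Y lY dY] /= /funext XY; rewrite XY in lX dX *.
by congr VectorField; exact: Prop_irrelevance.
Qed.

Fact vf_zero_linear : linear (fun _ : smoothFun => 0 : smoothFun).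
Proof. by move=> a f g; rewrite scaler0 addr0. Qed.
Fact vf_zero_leibniz f g :
  (fun _ : smoothFun => 0 : smoothFun) (f * g) = 0 * g + f * 0.
Proof. by rewrite mul0r mulr0 addr0. Qed.
Definition vf_zero := VectorField vf_zero_linear vf_zero_leibniz.

Fact vf_add_linear X Y : linear (fun f => X f + Y f).
Proof. by move=> a f g; rewrite !linearP scalerDr addrACA. Qed.
Fact vf_add_leibniz X Y f g :
  X (f * g) + Y (f * g) = (X f + Y f) * g + f * (X g + Y g).
Proof. by rewrite !vf_leibniz mulrDl mulrDr addrACA. Qed.
Definition vf_add X Y :=
  VectorField (@vf_add_linear X Y) (@vf_add_leibniz X Y).

Fact vf_scale_linear h X : linear (fun f => h * X f).
Proof. by move=> a f g; rewrite linearP mulrDr sf_scaleAr. Qed.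
Fact vf_scale_leibniz h X f g :
  h * X (f * g) = (h * X f) * g + f * (h * X g).
Proof. by rewrite vf_leibniz mulrDr mulrA (mulrCA h f). Qed.
Definition vf_scale h X :=
  VectorField (@vf_scale_linear h X) (@vf_scale_leibniz h X).

Definition vf_opp X := vf_scale (-1) X.

Lemma vf_addA : associative vf_add.
Proof. by move=> X Y Z; apply: vfP => f /=; rewrite addrA. Qed.
Lemma vf_addC : commutative vf_add.
Proof. by move=> X Y; apply: vfP => f /=; rewrite addrC. Qed.
Lemma vf_add0 : left_id vf_zero vf_add.
Proof. by move=> X; apply: vfP => f /=; rewrite add0r. Qed.
Lemma vf_addN : left_inverse vf_zero vf_opp vf_add.
Proof. by move=> X; apply: vfP => f /=; rewrite mulN1r addNr. Qed.

HB.instance Definition _ :=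
  GRing.isZmodule.Build vectorField vf_addA vf_addC vf_add0 vf_addN.

Lemma vf_scaleA h k X : vf_scale h (vf_scale k X) = vf_scale (h * k) X.
Proof. by apply: vfP => f /=; rewrite mulrA. Qed.
Lemma vf_scale1 : left_id 1 vf_scale.
Proof. by move=> X; apply: vfP => f /=; rewrite mul1r. Qed.
Lemma vf_scaleDr : right_distributive vf_scale +%R.
Proof. by move=> h X Y; apply: vfP => f /=; rewrite mulrDr. Qed.
Lemma vf_scaleDl X : {morph vf_scale^~ X : h k / h + k}.
Proof. by move=> h k; apply: vfP => f /=; rewrite mulrDl. Qed.

HB.instance Definition _ := GRing.Zmodule_isLmodule.Build smoothFun vectorField
  vf_scaleA vf_scale1 vf_scaleDr vf_scaleDl.

Lemma vfDE X Y f : (X + Y) f = X f + Y f. Proof. by []. Qed.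
Lemma vfNE X f : (- X) f = - X f.
Proof. by rewrite -[RHS]mulN1r. Qed.
Lemma vfZE h X f : (h *: X) f = h * X f. Proof. by []. Qed.

Fact bracket_linear X Y : linear (fun f => X (Y f) - Y (X f)).
Proof.
by move=> a f g; rewrite !(vf_linear X, vf_linear Y) scalerBr opprD addrACA.
Qed.
Fact bracket_leibniz X Y f g :
  X (Y (f * g)) - Y (X (f * g)) =
  (X (Y f) - Y (X f)) * g + f * (X (Y g) - Y (X g)).
Proof.
by rewrite !(vf_leibniz, vfD); ring.
Qed.

Definition bracket X Y :=
  VectorField (@bracket_linear X Y) (@bracket_leibniz X Y).

End SmoothFunctions.

Arguments smoothFun {R m} M.
Arguments vectorField {R m} M.

(* Tensor fields are identified with C^oo(M)-multilinear maps: a 1-form is a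
   C^oo(M)-linear map vectorField M -> smoothFun M, and a (1,1)-tensor field is
   a C^oo(M)-linear endomorphism of vectorField M. *)

Section Forms.
Variables (R : realType) (m : nat) (M : manifold R m).
Local Notation C := (smoothFun M).
Local Notation V := (vectorField M).
Implicit Types (X Y Z : V) (P : V -> Prop).

(* d eta and d Phi, without numerical factors. *)
Definition d1 (eta : V -> C) X Y : C :=
  X (eta Y) - Y (eta X) - eta (bracket X Y).

Definition d2 (Phi : V -> V -> C) X Y Z : C :=
  X (Phi Y Z) + Y (Phi Z X) + Z (Phi X Y)
  - Phi (bracket X Y) Z - Phi (bracket Y Z) X - Phi (bracket Z X) Y.

(* The restriction of T to the sections satisfying P is a 3-form. *)
Definition three_form_on P (T : V -> V -> V -> C) : Prop :=
  [/\ forall f X X' Y Z, P X -> P X' -> P Y -> P Z ->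
        T (f *: X + X') Y Z = f * T X Y Z + T X' Y Z,
      forall X Y Z, P X -> P Y -> P Z -> T X Y Z = - T Y X Z
    & forall X Y Z, P X -> P Y -> P Z -> T X Y Z = - T X Z Y].

(* In metric_pos, the hypothesis says that the tangent vector X_p is nonzero. *)
Record riemannianMetric := RiemannianMetric {
  metric :> V -> V -> C ;
  metric_sym : forall X Y, metric X Y = metric Y X ;
  metric_linear : forall X, scalar (metric X) ;
  metric_pos : forall X (p : M),
    (exists f : C, X f p != 0) -> 0 < metric X X p
}.

Variable g : riemannianMetric.

Definition Killing (xi : V) : Prop :=
  forall X Y, xi (g X Y) = g (bracket xi X) Y + g X (bracket xi Y).

Definition connection (nabla : V -> V -> V) : Prop :=
  [/\ forall Y, linear (nabla^~ Y),
      forall X Y Y', nabla X (Y + Y') = nabla X Y + nabla X Y'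
    & forall X (f : C) Y, nabla X (f *: Y) = X f *: Y + f *: nabla X Y].

Definition metric_connection nabla : Prop :=
  connection nabla /\
  forall X Y Z, X (g Y Z) = g (nabla X Y) Z + g Y (nabla X Z).

Definition torsion (nabla : V -> V -> V) X Y Z : C :=
  g (nabla X Y - nabla Y X - bracket X Y) Z.

Definition skew_torsion nabla : Prop :=
  three_form_on (fun=> True) (torsion nabla).

(* (nabla_X phi) Y *)
Definition nabla_endo (nabla : V -> V -> V) X (phi : V -> V) Y : V :=
  nabla X (phi Y) - phi (nabla X Y).

End Forms.

Record contactData (R : realType) (m : nat) (M : manifold R m) := ContactData {
  cd_phi : vectorField M -> vectorField M ;
  cd_xi : vectorField M ;
  cd_eta : vectorField M -> smoothFun M
}.

(* (i, j, k) is an even permutation of (0, 1, 2), which stands for (1, 2, 3). *)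
Definition even_triple (i j k : 'I_3) : bool :=
  [exists s : 'S_3, [&& ~~ odd_perm s, s 0 == i, s 1 == j & s 2%:R == k]].

Definition odd_triple (i j k : 'I_3) : bool :=
  [exists s : 'S_3, [&& odd_perm s, s 0 == i, s 1 == j & s 2%:R == k]].

Definition epsilon (R : realType) (i j k : 'I_3) : R :=
  if even_triple i j k then 1 else if odd_triple i j k then -1 else 0.

Section ContactGeometry.
Variables (R : realType) (m : nat) (M : manifold R m) (g : riemannianMetric M).
Local Notation C := (smoothFun M).
Local Notation V := (vectorField M).
Implicit Types (X Y Z : V) (s : contactData M) (S : 'I_3 -> contactData M).
Implicit Types (nabla : V -> V -> V).

Definition almost_contact_metric s : Prop :=
  let: ContactData phi xi eta := s in
  [/\ linear phi,
      scalar eta,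
      forall X, phi (phi X) = - X + eta X *: xi,
      eta xi = 1
    & forall X Y, g (phi X) (phi Y) = g X Y - eta X * eta Y].

Definition fundamental_form s X Y : C := g X (cd_phi s Y).

Definition Nijenhuis s X Y : V :=
  let: ContactData phi xi eta := s in
  bracket (phi X) (phi Y) + phi (phi (bracket X Y))
  - phi (bracket (phi X) Y) - phi (bracket X (phi Y)) + d1 eta X Y *: xi.

(* N_phi (X, Y, Z) - d Phi (phi X, phi Y, phi Z) *)
Definition Nijenhuis_minus_dPhi s X Y Z : C :=
  let phi := cd_phi s in
  g (Nijenhuis s X Y) Z - d2 (fundamental_form s) (phi X) (phi Y) (phi Z).

(* The dimension 4n+3 of M is imposed separately. *)
Definition almost_3_contact_metric S : Prop :=
  let phi i := cd_phi (S i) in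
  let xi i := cd_xi (S i) in
  let eta i := cd_eta (S i) in
  (forall i, almost_contact_metric (S i)) /\
  forall i j k, even_triple i j k ->
    [/\ forall X, phi k X = phi i (phi j X) - eta j X *: xi i,
        forall X, phi k X = - phi j (phi i X) + eta i X *: xi j,
        xi k = phi i (xi j) /\ xi k = - phi j (xi i)
      & forall X, eta k X = eta i (phi j X) /\ eta k X = - eta j (phi i X)].

Definition horizontal S X : Prop := forall i, cd_eta (S i) X = 0.

Definition vertical S X : Prop :=
  exists f : 'I_3 -> C, X = \sum_i f i *: cd_xi (S i).

(* a i *: 1 is the constant function a i, since vector fields only form a module
   over C^oo(M). *)
Definition combination S (a : 'I_3 -> R) : contactData M :=
  ContactData (fun X => \sum_i (a i *: (1 : C)) *: cd_phi (S i) X)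
              (\sum_i (a i *: (1 : C)) *: cd_xi (S i))
              (fun X => \sum_i a i *: cd_eta (S i) X).

Definition associated_sphere S s : Prop :=
  exists a : 'I_3 -> R, \sum_i a i ^+ 2 = 1 /\ s = combination S a.

Definition A_form S (i j : 'I_3) X Y : C :=
  let phi := cd_phi (S i) in
  let xi := cd_xi (S j) in
  let eta := cd_eta (S j) in
  g (bracket xi (phi X) - phi (bracket xi X)) Y
  + d1 eta X (phi Y) + d1 eta (phi X) Y.

Definition Reeb_Killing_function S (beta : C) : Prop :=
  forall X Y, horizontal S X -> horizontal S Y ->
    (forall i, A_form S i i X Y = 0) /\
    forall i j k, even_triple i j k ->
      A_form S i j X Y = - A_form S j i X Y /\
      A_form S i j X Y = beta * fundamental_form (S k) X Y.

Definition canonical S : Prop :=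
  [/\ forall i,
        three_form_on (horizontal S) (fun X Y Z => g (Nijenhuis (S i) X Y) Z),
      forall i, Killing g (cd_xi (S i)),
      forall i j X Y Z, horizontal S X -> horizontal S Y -> horizontal S Z ->
        Nijenhuis_minus_dPhi (S i) X Y Z = Nijenhuis_minus_dPhi (S j) X Y Z
    & exists beta, Reeb_Killing_function S beta].

Definition Reeb_commutator_function S (delta : C) : Prop :=
  forall i j k, cd_eta (S k) (bracket (cd_xi (S i)) (cd_xi (S j))) =
                (2 * epsilon R i j k) *: delta.

Definition phi_compatible S s nabla : Prop :=
  [/\ metric_connection g nabla /\ skew_torsion g nabla,
      forall X Y, horizontal S Y -> horizontal S (nabla X Y),
      forall X Y, vertical S Y -> vertical S (nabla X Y)
    & forall X Y, horizontal S X -> horizontal S Y ->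
        nabla_endo nabla X (cd_phi s) Y = 0].

(* nabla_X phi_i = b (eta_k(X) phi_j - eta_j(X) phi_k) *)
Definition rotates_structures S nabla (b : C) : Prop :=
  forall i j k, even_triple i j k -> forall X Y,
    nabla_endo nabla X (cd_phi (S i)) Y =
    b *: (cd_eta (S k) X *: cd_phi (S j) Y - cd_eta (S j) X *: cd_phi (S k) Y).

Definition canonical_connection S nabla (b : C) : Prop :=
  [/\ metric_connection g nabla, skew_torsion g nabla
    & rotates_structures S nabla b].

End ContactGeometry.

(* Main.v *)
(* The vector fields of the statement are all derivations of the ring of smooth
   functions, so the one analytic input is that a linear form on them is the metric
   dual of a field. Near a point, cutting off the coordinates of a chart gives global
   fields; by Hadamard's lemma they span all derivations there, and inverting their
   Gram matrix gives a local dual field. Local dual fields agree on overlaps because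
   the metric is definite. By Koszul's formula every 3-form is then the torsion of a
   unique metric connection.

   If [nabla] rotates the structures, applying [nabla phi_i] to [xi_i] gives
   [nabla_X xi_i = b (eta_k(X) xi_j - eta_j(X) xi_k)]. Hence [xi_i] is Killing, the
   horizontal distribution is parallel, and [T(X, Y, xi_i)] is
   [d eta_i + 2 b eta_j /\ eta_k]. Writing [F(X, Y) = (nabla_X phi) Y], one has on
   the horizontal distribution
     [N(X, Y, Z) - d Phi(phi X, phi Y, phi Z)
        = T(X, Y, Z) + g(F(X, Y), phi Z) - g(F(Y, X), phi Z) - g(F(phi Z, X), Y)],
   and [A_ij(X, Y) = g((nabla_(xi_j) phi_i) X, Y)]. This determines [T].

   Conversely these values of [T] glue to a 3-form exactly because the [xi_i] are
   Killing, and the displayed identity forces [F = 0] on the horizontal distribution. *)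
From HB Require Import structures.
From mathcomp Require Import all_boot all_order all_algebra all_fingroup.
From mathcomp Require Import mathcomp_extra boolp classical_sets functions.
From mathcomp Require Import reals ereal topology normedtype sequences derive.
From mathcomp Require Import realfun exp measure lebesgue_measure.
From mathcomp Require Import lebesgue_integral ftc.
From mathcomp Require Import ring lra.
Require Import Defs.

Set Implicit Arguments.
Unset Strict Implicit.
Unset Printing Implicit Defensive.

Import Order.TTheory GRing.Theory Num.Theory.
Import numFieldNormedType.Exports.

Local Open Scope classical_set_scope.
Local Open Scope ring_scope.

(** * Calculus on open sets of coordinate space *)

(** Since fields are derivations of the ring of global functions, nothing about them is local at
    first: chart coordinates are not in their domain, and neither their value at a point nor a local
    frame is given. Hence the bump functions, and hence expansions in a frame that hold only after
    multiplication by a power of a cutoff. The ring has zero divisors as well, so division by a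
    function is replaced by evaluation at points.

    In the converse direction the connection is found through its torsion. For Killing [xi_i] and
    skew torsion, [2 g(nabla_X xi_i, Y) = d eta_i(X, Y) - T(X, Y, xi_i)], so the term [2 b] in the
    torsion is exactly what makes the [xi_i] rotate with speed [b]. This works for any function [b];
    the derivative of [phi_i] along the [xi_l], on horizontal fields, is what ties [b] to the Reeb
    Killing function.

    In dimension 3 there are no nonzero horizontal fields: every function is then a Reeb Killing
    function, and on a canonical manifold each one has its own connection. Uniqueness is therefore
    claimed for [0 < n]. *)

Lemma is_derive_line (R : realType) (V : normedModType R) (f : V -> R) (x v : V)
    (t d : R) :
  is_derive t 1 (fun s => f (x + s *: v)) d <-> is_derive (x + t *: v) v f d.
Proof.
have E : (fun h : R => h^-1 *: ((f \o shift (x + t *: v)) (h *: v) - f (x + t *: v)))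
  = (fun h : R => h^-1 *: (((fun s => f (x + s *: v)) \o shift t) (h *: (1:R)) -
        f (x + t *: v))).
  apply/funext => h /=; congr (_ *: (f _ - _)).
  by rewrite scaler1 scalerDl addrCA.
by split=> -[df Df]; apply: DeriveDef; rewrite ?/derivable ?/derive ?E // -E.
Qed.

Lemma is_derive_comp_real (R : realType) (V : normedModType R) (f : R -> R)
    (l : V -> R) (x v : V) (df dl : R) :
  is_derive (l x) 1 f df -> is_derive x v l dl -> is_derive x v (f \o l) (df * dl).
Proof.
rewrite -[x]addr0 -(scale0r v) => Df Dl; apply/is_derive_line.
have {}Dl := (is_derive_line l x v 0 dl).2 Dl.
exact: (is_derive1_comp Df Dl).
Qed.

(** The intermediate point is [x + (t * s) *: v] with [t] in the unit interval, so that one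
    statement serves increments [s] of either sign; coordinate increments have both. *)
Lemma mean_value_line (R : realType) (V : normedModType R) (f : V -> R) (x v : V)
    (s : R) :
  (forall t, 0 <= t <= 1 -> derivable f (x + (t * s) *: v) v) ->
  exists2 t, 0 <= t <= 1 &
    f (x + s *: v) - f x = 'D_v f (x + (t * s) *: v) * s.
Proof.
move=> df; pose g u := f (x + u *: v).
have dg u : derivable f (x + u *: v) v ->
    is_derive u 1 g ('D_v f (x + u *: v)).
  by move=> du; apply/is_derive_line; apply: DeriveDef.
have [s0|s0|s0] := ltgtP s 0.
- have inI u : u \in `[s, 0] -> exists2 t, 0 <= t <= 1 & u = t * s.
    rewrite in_itv /= => /andP[su u0]; exists (u / s); last by rewrite divfK ?lt_eqF.
    by rewrite ler_ndivrMr // mul1r su ler_ndivlMr // mul0r u0.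
  have [| |c /inI[t t01 ->]] := @MVT_segment R g (fun u => 'D_v f (x + u *: v)) s 0 (ltW s0).
  + by move=> u /subset_itv_oo_cc /inI[t t01 ->]; apply: dg; exact: df.
  + apply: derivable_within_continuous => u /inI[t t01 ->].
    by have [] := dg _ (df _ t01).
  rewrite /g scale0r addr0 => e; exists t => //.
  by rewrite -opprB e; ring.
- have inI u : u \in `[0, s] -> exists2 t, 0 <= t <= 1 & u = t * s.
    rewrite in_itv /= => /andP[su u0]; exists (u / s); last by rewrite divfK ?gt_eqF.
    by rewrite ler_pdivrMr // mul1r u0 ler_pdivlMr // mul0r su.
  have [| |c /inI[t t01 ->]] := @MVT_segment R g (fun u => 'D_v f (x + u *: v)) 0 s (ltW s0).
  + by move=> u /subset_itv_oo_cc /inI[t t01 ->]; apply: dg; exact: df.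
  + apply: derivable_within_continuous => u /inI[t t01 ->].
    by have [] := dg _ (df _ t01).
  by rewrite /g scale0r addr0 subr0 => e; exists t.
- by exists 0; [rewrite lexx ler01|rewrite s0 scale0r addr0 subrr mulr0].
Qed.

Lemma ball_rVP (R : realType) (m : nat) (a x : 'rV[R]_m) (r : R) :
  ball a r x <-> 0 < r /\ forall j, `|a 0 j - x 0 j| < r.
Proof.
split=> [[r0 ax]|[r0 ax]]; split=> //.
  by move=> j; exact: ax.
by move=> i j; rewrite (ord1 i); exact: ax.
Qed.

Lemma rV_normP (R : realType) (m : nat) (x : 'rV[R]_m) (e : R) :
  0 <= e -> reflect (forall j, `|x 0 j| <= e) (`|x| <= e).
Proof.
move=> e0; rewrite [`|x|]/Num.norm /= mx_normrE.
apply: (iffP (bigmax_leP _ _ _ _)) => [[_ xe] j|xe]; first exact: (xe (0, j)).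
by split=> // -[i j] _; rewrite (ord1 i); exact: xe.
Qed.

(** Coordinates are moved from [a] to [y] one at a time, with the one-variable mean value theorem
    for each move. Balls of the max norm are boxes, so this path stays in the ball and partial
    derivatives suffice. *)
Lemma mean_value_ball (R : realType) (m : nat) (f : 'rV[R]_m -> R)
    (a0 a y : 'rV[R]_m) (r : R) :
  (forall x j, ball a0 r x -> derivable f x 'e_j) ->
  ball a0 r a -> ball a0 r y ->
  exists xi : 'I_m -> 'rV[R]_m,
    (forall j, ball a0 r (xi j) /\ `|xi j - a| <= `|y - a|) /\
    f y - f a = \sum_j 'D_('e_j) f (xi j) * (y 0 j - a 0 j).
Proof.
move=> df aB yB; have [r0 aB'] := (ball_rVP a0 a r).1 aB.
have [_ yB'] := (ball_rVP a0 y r).1 yB.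
have btw (x : 'rV[R]_m) :
    (forall i, exists2 t, 0 <= t <= 1 & x 0 i = a 0 i + t * (y 0 i - a 0 i)) ->
    ball a0 r x /\ `|x - a| <= `|y - a|.
  move=> xt; split.
    apply/ball_rVP; split=> // i; have [t /andP[t0 t1] ->] := xt i.
    have -> : a0 0 i - (a 0 i + t * (y 0 i - a 0 i)) =
      (1 - t) * (a0 0 i - a 0 i) + t * (a0 0 i - y 0 i) by ring.
    have := aB' i; have := yB' i; rewrite !ltr_norml => /andP[? ?] /andP[? ?].
    move: t0; rewrite le_eqVlt => /predU1P[<-|t0]; first by apply/andP; split; lra.
    by apply/andP; split; nra.
  apply/rV_normP => // i; have [t /andP[t0 t1] e] := xt i.
  rewrite !mxE e addrC addKr normrM ger0_norm //.
  have /rV_normP /(_ i) := lexx `|y - a|; rewrite !mxE => h.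
  by apply: le_trans (h _) => //; rewrite ler_piMl.
pose P k : 'rV[R]_m := \row_i (if (i < k)%N then y 0 i else a 0 i).
have PS (j : 'I_m) : P j.+1 = P j + (y 0 j - a 0 j) *: 'e_j.
  apply/rowP => i; rewrite !mxE ltnS leq_eqVlt eqxx val_eqE /=.
  have [->|ij] := eqVneq i j; first by rewrite ltnn mulr1 addrC subrK.
  by rewrite mulr0 addr0.
have Pbtw (j : 'I_m) t : 0 <= t <= 1 ->
    ball a0 r (P j + (t * (y 0 j - a 0 j)) *: 'e_j) /\
    `|P j + (t * (y 0 j - a 0 j)) *: 'e_j - a| <= `|y - a|.
  move=> t01; apply: btw => i; rewrite !mxE eqxx /=.
  have [->|_] := eqVneq i j; first by exists t => //; rewrite ltnn mulr1.
  rewrite mulr0 addr0; case: ifP => _.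
    by exists 1; rewrite ?ler01 ?lexx // mul1r addrC subrK.
  by exists 0; rewrite ?ler01 ?lexx // mul0r addr0.
have step (j : 'I_m) : exists x, (ball a0 r x /\ `|x - a| <= `|y - a|) /\
    f (P j.+1) - f (P j) = 'D_('e_j) f x * (y 0 j - a 0 j).
  have [t /(Pbtw j)[/df + _]|t t01 e] :=
    @mean_value_line R _ f (P j) 'e_j (y 0 j - a 0 j); first exact.
  exists (P j + (t * (y 0 j - a 0 j)) *: 'e_j); split; first exact: Pbtw.
  by rewrite PS e.
have [xi xiP] := choice step; exists xi; split=> [j|]; first exact: (xiP j).1.
rewrite -(eq_bigr _ (fun j _ => (xiP j).2)).
rewrite -(big_mkord xpredT (fun k => f (P k.+1) - f (P k))) telescope_sumr //.
congr (f _ - f _); apply/rowP => i; rewrite mxE; first by rewrite ltn_ord.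
by [].
Qed.

Lemma cvg_rV (R : realType) (m : nat) (T : Type) (F : set_system T)
    (FF : Filter F) (G : T -> 'rV[R]_m) (a : 'rV[R]_m) :
  (forall j, G t 0 j @[t --> F] --> a 0 j) -> G @ F --> a.
Proof.
move=> Ga; apply/cvgrPdist_le => e e0.
have H := filter_forall _ (fun j => (cvgrPdist_le _ _).1 (Ga j) e e0).
near=> t; have at_le j : `|a 0 j - G t 0 j| <= e by move: j; near: t; exact: H.
by apply/rV_normP => [|j]; [exact: ltW|rewrite !mxE].
Unshelve. all: by end_near. Qed.

(* Only the derivatives of the components of [G] along [v] are used, so that the
   same statement covers compositions of charts and curves. *)
Lemma is_derive_chain (R : realType) (m : nat) (V : normedModType R)
    (U : set 'rV[R]_m) (f : 'rV[R]_m -> R) (G : V -> 'rV[R]_m) (x v : V)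
    (d : 'I_m -> R) :
  open U -> Ck 1 U f -> U (G x) ->
  (forall j, is_derive x v (fun z => G z 0 j) (d j)) ->
  is_derive x v (f \o G) (\sum_j 'D_('e_j) f (G x) * d j).
Proof.
move=> oU [cf Df] UGx dG.
have [r /= r0 rU] : exists2 r, 0 < r & ball (G x) r `<=` U.
  by have /nbhs_ballP[r r0 rU] := open_nbhs_nbhs (conj oU UGx); exists r.
pose Q j h : R := h^-1 *: (G (h *: v + x) 0 j - G x 0 j).
have cQ j : Q j h @[h --> 0^'] --> d j.
  by have [dj <-] := dG j; exact: dj.
have cG : G (h *: v + x) @[h --> 0^'] --> G x.
  apply: cvg_rV => j; apply/cvgrPdist_le => e e0.
  have c0 : h *: Q j h @[h --> (0:R)^'] --> (0:R).
    rewrite -[X in _ --> X](scale0r (d j)); apply: cvgZ => //; exact: cvg_within.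
  have /cvgr0Pnorm_le/(_ e e0) := c0.
  apply: filterS2 (nbhs_dnbhs_neq (0 : R)) => h h0.
  by rewrite /Q scalerA divff // scale1r distrC.
(* [choice] needs a witness for every [h]: where [G] leaves the ball, the constant [G x] satisfies
   the norm bound and the expansion is vacuous. *)
have mv h : exists xi : 'I_m -> 'rV[R]_m,
    (forall j, `|xi j - G x| <= `|G (h *: v + x) - G x|) /\
    (ball (G x) r (G (h *: v + x)) -> f (G (h *: v + x)) - f (G x) =
     \sum_j 'D_('e_j) f (xi j) * (G (h *: v + x) 0 j - G x 0 j)).
  have [hB|nB] := pselect (ball (G x) r (G (h *: v + x))); last first.
    by exists (fun=> G x); split=> // j; rewrite subrr normr0.
  have [|xi [xi1 xi2]] := @mean_value_ball R m f (G x) (G x) _ r _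
    (ballxx _ r0) hB.
    by move=> z j zB; have [+ _] := Df j; apply; exact: rU.
  by exists xi; split=> // j; have [] := xi1 j.
have [xi xiP] := choice mv.
have cxi j : xi h j @[h --> 0^'] --> G x.
  apply/cvgrPdist_le => e e0; have /cvgrPdist_le/(_ e e0) := cG.
  apply: filterS => h he; rewrite distrC; apply: le_trans ((xiP h).1 j) _.
  by rewrite distrC.
have main : h^-1 *: (f (G (h *: v + x)) - f (G x)) @[h --> 0^'] -->
    \sum_j 'D_('e_j) f (G x) * d j.
  have : (\sum_j 'D_('e_j) f (xi h j) * Q j h) @[h --> 0^'] -->
      \sum_j 'D_('e_j) f (G x) * d j.
    apply: cvg_big => [|j _]; first exact: add_continuous.
    apply: cvgM; last exact: cQ.
    have [_ [c' _]] := Df j.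
    exact: (@cvg_comp _ _ _ _ _ _ _ _ (cxi j) (c' _ UGx)).
  apply: cvg_trans; apply: near_eq_cvg.
  have /cvg_ballP/(_ r r0) := cG; apply: filterS => h hB.
  rewrite (xiP h).2 // scaler_sumr; apply: eq_bigr => j _.
  exact: mulrCA.
apply: DeriveDef; first by apply/cvg_ex; exists (\sum_j 'D_('e_j) f (G x) * d j).
exact: cvg_lim.
Qed.

Section CkTheory.
Variables (R : realType) (m : nat).
Implicit Types (U : set 'rV[R]_m) (f g : 'rV[R]_m -> R).

Lemma Ck_sub k U U' f : U' `<=` U -> Ck k U f -> Ck k U' f.
Proof.
move=> UU'; elim: k f => [|k IH] f [cf Df]; split=> //.
1,2: by move=> x /UU'; exact: cf.
move=> i; have [df cdf] := Df i; split; last exact: IH.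
by move=> x /UU'; exact: df.
Qed.

(** Allows a different formula near each point: needed for chart functions extended by [0] and for
    the dual field glued from local ones. *)
Lemma Ck_local k U f :
  (forall x, U x -> exists U', [/\ open U', U' x & Ck k U' f]) -> Ck k U f.
Proof.
elim: k f => [|k IH] f H; split=> //.
1,2: by move=> x /H[U' [_ U'x [cf _]]]; exact: cf.
move=> i; split=> [x /H[U' [_ U'x [_ Df]]]|]; first by have [+ _] := Df i; exact.
by apply: IH => x /H[U' [oU' U'x [_ Df]]]; exists U'; split=> //; have [] := Df i.
Qed.

Lemma CkS1 k U f : Ck k.+1 U f -> Ck 1 U f.
Proof. by elim: k => // k IH /CkW/IH. Qed.

Lemma Ck_sum k U (I : Type) (r : seq I) (F : I -> 'rV[R]_m -> R) : open U ->
  (forall i, Ck k U (F i)) -> Ck k U (fun x => \sum_(i <- r) F i x).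
Proof.
move=> oU cF; elim: r => [|i r IH].
  by apply: (Ck_eq oU _ (Ck_cst k U 0)) => x _; rewrite big_nil.
by apply: (Ck_eq oU _ (CkD oU (cF i) IH)) => x _; rewrite big_cons.
Qed.

Lemma Ck_prod k U (I : Type) (r : seq I) (F : I -> 'rV[R]_m -> R) : open U ->
  (forall i, Ck k U (F i)) -> Ck k U (fun x => \prod_(i <- r) F i x).
Proof.
move=> oU cF; elim: r => [|i r IH].
  by apply: (Ck_eq oU _ (Ck_cst k U 1)) => x _; rewrite big_nil.
by apply: (Ck_eq oU _ (CkM oU (cF i) IH)) => x _; rewrite big_cons.
Qed.

Lemma is_derive_coord (x v : 'rV[R]_m) j :
  is_derive x v (fun y : 'rV[R]_m => y 0 j) (v 0 j).
Proof.
have e : (fun h : R => h^-1 *: (((fun y : 'rV[R]_m => y 0 j) \o shift x) (h *: v) - x 0 j))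
    @ 0^' --> v 0 j.
  apply: cvg_near_cst; near=> h; rewrite /= !mxE addrK.
  by rewrite [_ *: _]mulKf //; near: h; exact: nbhs_dnbhs_neq.
by apply: DeriveDef; [apply/cvg_ex; exists (v 0 j)|exact: cvg_lim].
Unshelve. all: by end_near. Qed.

Lemma Ck_coord k U j : open U -> Ck k U (fun x => x 0 j).
Proof.
move=> oU; case: k => [|k]; split=> //.
1,2: by move=> x _; exact: coord_continuous.
move=> i; split=> [x _|]; first by have [] := is_derive_coord x 'e_i j.
apply: (Ck_eq oU _ (Ck_cst k U (('e_i : 'rV[R]_m) 0 j))) => x _.
by have [_ ->] := is_derive_coord x 'e_i j.
Qed.

Lemma Ck_inv k U f : open U -> (forall x, U x -> f x != 0) ->
  Ck k U f -> Ck k U (fun x => (f x)^-1).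
Proof.
move=> oU f0; elim: k => [|k IH] cf; split=> //.
1,2: by move=> x Ux; exact: cvgV (f0 x Ux) (cf.1 x Ux).
move=> i; have [df cdf] := cf.2 i; split=> [x Ux|].
  by apply: derivableV; [exact: f0|exact: df].
have c2 := CkM oU (IH (CkW cf)) (IH (CkW cf)).
apply: (Ck_eq oU _ (CkM oU (CkM oU (Ck_cst k U (-1)) c2) cdf)) => x Ux.
by rewrite (deriveV (f0 x Ux) (df x Ux)) mulN1r -invfM -expr2.
Qed.

End CkTheory.

Lemma Ck_comp (R : realType) (m p k : nat) (U : set 'rV[R]_p) (W : set 'rV[R]_m) (f : 'rV[R]_p -> R)
    (G : 'rV[R]_m -> 'rV[R]_p) :
  open U -> open W -> (forall x, W x -> U (G x)) ->
  (forall j, Ck k W (fun x => G x 0 j)) -> Ck k U f -> Ck k W (f \o G).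
Proof.
move=> oU oW WU; elim: k f => [|k IH] f cG cf.
  split=> // x Wx; apply: (@continuous_comp _ _ _ G f); last exact: cf.1 (WU _ Wx).
  by apply: (@cvg_rV _ _ _ (nbhs x) _) => j; have [+ _] := cG j; exact.
have chain x i : W x ->
    is_derive x 'e_i (f \o G) (\sum_j 'D_('e_j) f (G x) * 'D_('e_i) (fun x => G x 0 j) x).
  move=> Wx; apply: (is_derive_chain oU (CkS1 cf) (WU _ Wx)) => j.
  by apply: DeriveDef => //; have [_ /(_ i)[+ _]] := cG j; exact.
split=> [x Wx|i].
  apply: (@continuous_comp _ _ _ G f); last exact: cf.1 (WU _ Wx).
  by apply: (@cvg_rV _ _ _ (nbhs x) _) => j; have [+ _] := cG j; exact.
split=> [x Wx|]; first by have [] := chain x i Wx.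
apply: (@Ck_eq _ _ k W
  (fun x => \sum_j 'D_('e_j) f (G x) * 'D_('e_i) (fun x => G x 0 j) x) _ oW).
  by move=> x /(chain x i)[_ ->].
apply: (Ck_sum _ oW (F := fun j x =>
  'D_('e_j) f (G x) * 'D_('e_i) (fun x => G x 0 j) x)) => j; apply: CkM => //.
  by apply: (IH ('D_('e_j) f)) => [j'|]; [exact: CkW|have [_ /(_ j)[]] := cf].
by have [_ /(_ i)[]] := cG j.
Qed.

(** * Bump functions *)

Section Flat.
Variable R : realType.

(** For [n = 0] this is the classical flat function [exp(-1/t)]. The powers of [1/t] close the
    family under differentiation, so smoothness is an induction over all [n] at once. *)
Definition flat (n : nat) (t : R) : R :=
  if t <= 0 then 0 else t^-1 ^+ n * expR (- t^-1).

Lemma flat_le0 n t : t <= 0 -> flat n t = 0.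
Proof. by rewrite /flat => ->. Qed.

Lemma flat_gt0 n t : 0 < t -> 0 < flat n t.
Proof.
by move=> t0; rewrite /flat leNgt t0 mulr_gt0 ?expR_gt0 ?exprn_gt0 ?invr_gt0.
Qed.

(* From [1 + s/(n+1) <= exp (s/(n+1))] at [s = 1/t]. *)
Lemma flat_bound n t : `|flat n t| <= n.+1%:R ^+ n.+1 * `|t|.
Proof.
have [t0|t0] := leP t 0.
  by rewrite flat_le0 // normr0 mulr_ge0 ?exprn_ge0.
rewrite (gtr0_norm (flat_gt0 n t0)) (gtr0_norm t0) /flat [t <= 0]leNgt t0 /=.
set s := t^-1; have s0 : 0 < s by rewrite invr_gt0.
have n0 : 0 < n.+1%:R :> R by rewrite ltr0n.
have le1 : (s / n.+1%:R) ^+ n.+1 <= expR s.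
  have -> : expR s = expR (s / n.+1%:R) ^+ n.+1.
    by rewrite -expRM_natl mulrC divfK ?gt_eqF.
  rewrite lerXn2r ?nnegrE ?expR_ge0 //; first by rewrite divr_ge0 // ltW.
  by apply: le_trans (expR_ge1Dx _); rewrite lerDr.
have -> : t = s^-1 by rewrite invrK.
rewrite expRN. rewrite ler_pdivrMr ?expR_gt0 // mulrAC ler_pdivlMr // -exprSr.
by move: le1; rewrite expr_div_n ler_pdivrMr ?exprn_gt0 // mulrC.
Qed.

Lemma flat_cvg0 n : flat n t @[t --> 0] --> 0.
Proof.
have c0 : n.+1%:R ^+ n.+1 * `|t| @[t --> (0 : R)] --> (0 : R).
  rewrite -[X in _ --> X](mulr0 (n.+1%:R ^+ n.+1)) -[X in _ * X](@normr0 _ R).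
  by apply: cvgMr; apply: norm_continuous.
apply: norm_cvg0.
apply: (squeeze_cvgr _ (cvg_cst 0) c0).
by apply: nearW => t; rewrite normr_ge0 flat_bound.
Qed.

Lemma is_derive_flat n (t : R) :
  is_derive t 1 (flat n) (flat n.+2 t - n%:R * flat n.+1 t).
Proof.
have [t0|t0|->] := ltgtP t 0.
- rewrite !(flat_le0 _ (ltW t0)) mulr0 subr0.
  apply: (near_eq_is_derive _ (is_derive_cst 0 t 1)).
  near=> u; have u0 : u <= 0 by near: u; exact: lt_le_nbhsl.
  by rewrite flat_le0.
- have d : is_derive t 1 (fun u : R => u^-1 ^+ n * expR (- u^-1))
      (flat n.+2 t - n%:R * flat n.+1 t).
    have tn0 : t != 0 by rewrite gt_eqF.
    pose v (u : R) : R := u^-1.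
    have dv : is_derive t 1 v (- t^-1 ^+ 2).
      apply: DeriveDef; first exact: derivableV.
      by rewrite /v deriveV // derive_id scaler1 exprVn.
    have dvn : is_derive t 1 (v ^+ n) _ := is_deriveX n dv.
    have dE : is_derive t 1 (expR \o (- v)) _ :=
      is_derive1_comp (is_derive_expR _) (is_deriveN dv).
    have := is_deriveM dvn dE.
    rewrite (_ : v ^+ n * _ = fun u => u^-1 ^+ n * expR (- u^-1)); last first.
      by apply/funext => u; rewrite exprfctE.
    move=> d; apply: (is_derive_eq d).
    rewrite exprfctE /flat [t <= 0]leNgt t0 /= /v.
    have scaleE (a b : R) : a *: b = a * b by [].
    rewrite !scaleE !fctE; case: n {dvn d} => [|n] /=; first by ring.
    by rewrite !exprS; ring.
  apply: (near_eq_is_derive _ d).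
  near=> u; have u0 : 0 < u by near: u; exact: lt_nbhsr.
  by rewrite /flat leNgt u0.
- rewrite !flat_le0 // mulr0 subr0.
  (* At [0] the difference quotient of [flat n] is [flat n.+1] itself, on both sides of [0]. *)
  have main : h^-1 *: (flat n (h *: 1 + 0) - flat n 0) @[h --> (0:R)^'] --> (0:R).
    have fl : flat n.+1 h @[h --> (0:R)^'] --> (0:R).
      by apply: (cvg_trans _ (flat_cvg0 n.+1)); apply: cvg_app; exact: nbhs_dnbhs.
    apply: cvg_trans fl.
    apply: near_eq_cvg; near=> h.
    rewrite scaler1 addr0 (flat_le0 n (lexx 0)) subr0 /flat.
    by case: ifP => _; rewrite ?scaler0 // exprS -mulrA.
  by apply: DeriveDef; [apply/cvg_ex; exists 0|exact: cvg_lim].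
Unshelve. all: by end_near. Qed.
End Flat.

Section Bump.
Variables (R : realType) (m : nat).
Implicit Types (U : set 'rV[R]_m) (l : 'rV[R]_m -> R).

Lemma Ck_flat n k U l : open U -> Ck k U l -> Ck k U (fun x => flat n (l x)).
Proof.
move=> oU; elim: k n => [|k IH] n cl.
  split=> // x Ux; apply: (@continuous_comp _ _ _ l (flat n)); first exact: cl.1.
  by apply: differentiable_continuous; apply/derivable1_diffP;
    have [] := is_derive_flat n (l x).
have Dl x i : U x -> is_derive x 'e_i (flat n \o l)
    ((flat n.+2 (l x) - n%:R * flat n.+1 (l x)) * 'D_('e_i) l x).
  move=> Ux; apply: is_derive_comp_real (is_derive_flat _ _) _.
  by apply: DeriveDef => //; have [_ /(_ i)[+ _]] := cl; exact.
split=> [x Ux|i].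
  apply: (@continuous_comp _ _ _ l (flat n)); first exact: cl.1.
  by apply: differentiable_continuous; apply/derivable1_diffP;
    have [] := is_derive_flat n (l x).
split=> [x Ux|]; first by have [] := Dl x i Ux.
have cl' := CkW cl.
have c1 := CkD oU (IH n.+2 cl') (CkM oU (Ck_cst k U (- n%:R)) (IH n.+1 cl')).
have c2 : Ck k U ('D_('e_i) l) by have [_ /(_ i)[]] := cl.
apply: (Ck_eq oU _ (CkM oU c1 c2)) => x Ux.
by have [_ ->] := Dl x i Ux; rewrite mulNr.
Qed.

(** The two factors at [j] are both positive exactly when [x 0 j] is within [r] of [a 0 j]; as balls
    are boxes, the product is positive on the ball and vanishes off it. *)
Definition bump (a : 'rV[R]_m) (r : R) (x : 'rV[R]_m) : R :=
  \prod_j (flat 0 (r - (x 0 j - a 0 j)) * flat 0 (r + (x 0 j - a 0 j))).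

Lemma Ck_bump k U a r : open U -> Ck k U (bump a r).
Proof.
move=> oU; apply: Ck_prod => // j.
have c0 := CkD oU (Ck_coord k j oU) (Ck_cst k U (- a 0 j)).
have cN : Ck k U (fun x => - (x 0 j - a 0 j)).
  by apply: (Ck_eq oU _ (CkM oU (Ck_cst k U (-1)) c0)) => x _; rewrite mulN1r.
apply: (CkM oU); apply: (Ck_flat _ oU).
  exact: (CkD oU (Ck_cst k U r) cN).
exact: (CkD oU (Ck_cst k U r) c0).
Qed.

Lemma bump_gt0 a r x : ball a r x -> 0 < bump a r x.
Proof.
move=> /ball_rVP[r0 ax]; apply: prodr_gt0 => j _.
by have := ax j; rewrite ltr_norml => /andP[? ?]; rewrite mulr_gt0 ?flat_gt0 //; lra.
Qed.

Lemma bump_eq0 a r x : 0 < r -> ~ ball a r x -> bump a r x = 0.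
Proof.
move=> r0 nax; have [j axj] : exists j, ~~ (`|a 0 j - x 0 j| < r).
  apply/not_existsP => ax; apply: nax; apply/ball_rVP; split=> // j.
  by apply/negPn/negP; exact: ax.
rewrite /bump (bigD1 j) //=.
have [h|h] := leP (r - (x 0 j - a 0 j)) 0; first by rewrite flat_le0 // !mul0r.
rewrite [X in _ * X * _]flat_le0 ?mulr0 ?mul0r //.
move: axj; rewrite -leNgt ler_normr => /orP[]; lra.
Qed.

End Bump.

(** * Hadamard's lemma *)

Section Hadamard.
Variables (R : realType) (m : nat) (a0 a : 'rV[R]_m) (r : R).
Local Notation U := (ball a0 r).
Hypothesis Ua : U a.
Local Notation mu := (@lebesgue_measure R).
Local Notation I01 := (`[0%R, 1%R]%classic : set R).
Implicit Types (f : 'rV[R]_m -> R).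

Let ballE x : U x = (`|a0 - x| < r) :> Prop.
Proof. by rewrite -ball_normE. Qed.

Let I01P t : I01 t -> 0 <= t <= 1.
Proof. by rewrite /= in_itv. Qed.

Lemma ball_segment (s : R) x t : `|a0 - a| <= s -> `|a0 - x| <= s -> 0 <= t <= 1 ->
  `|a0 - (a + t *: (x - a))| <= s.
Proof.
move=> as_ xs /andP[t0 t1].
have -> : a0 - (a + t *: (x - a)) = (1 - t) *: (a0 - a) + t *: (a0 - x).
  by apply/rowP => j; rewrite !mxE; ring.
apply: le_trans (ler_normD _ _) _;
  rewrite !normrZ (ger0_norm t0) ger0_norm ?subr_ge0 //.
apply: (@le_trans _ _ ((1 - t) * s + t * s)); last by rewrite -mulrDl subrK mul1r.
by apply: lerD; apply: ler_wpM2l => //; rewrite subr_ge0.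
Qed.

Let Useg x t : U x -> 0 <= t <= 1 -> U (a + t *: (x - a)).
Proof.
rewrite !ballE => xU t01.
have aU : `|a0 - a| < r by rewrite -ballE.
apply: (@le_lt_trans _ _ (Num.max `|a0 - a| `|a0 - x|)); last by rewrite gt_max aU.
by apply: ball_segment => //; rewrite le_max lexx ?orbT.
Qed.

(** Each derivative in [x] brings out a factor [t]; the weight [t ^+ n] absorbs it, so the family is
    closed under partial derivatives. The expansion point [a] need not be the centre [a0]: later the
    ball of a chart is fixed while the expansion point varies. *)
Definition hadamard (n : nat) f x : R :=
  \int[mu]_(t in I01) (t ^+ n * f (a + t *: (x - a))).

Let cont_seg n f x : (forall y, U y -> {for y, continuous f}) -> U x ->
  {in I01, continuous (fun t : R => t ^+ n * f (a + t *: (x - a)))}.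
Proof.
move=> cf Ux t /set_mem/I01P t01; apply: cvgM; first exact: exprn_continuous.
apply: (@continuous_comp _ _ _ (fun t : R => a + t *: (x - a)) f).
  by apply: cvgD; [exact: cvg_cst|apply: cvgZl; exact: cvg_id].
by apply: cf; exact: Useg.
Qed.

Let int_seg n f x : (forall y, U y -> {for y, continuous f}) -> U x ->
  mu.-integrable I01 (EFin \o (fun t : R => t ^+ n * f (a + t *: (x - a)))).
Proof.
move=> cf Ux; apply: continuous_compact_integrable; first exact: segment_compact.
by apply: continuous_in_subspaceT; exact: cont_seg.
Qed.

Lemma hadamard_bound n f x (K : R) : (forall y, U y -> {for y, continuous f}) -> U x ->
  (forall t, 0 <= t <= 1 -> `|f (a + t *: (x - a))| <= K) -> `|hadamard n f x| <= K.
Proof.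
move=> cf Ux fK; have intf := int_seg n cf Ux.
apply: le_trans (le_normr_Rintegral _ intf) _ => //.
have muI : fine (mu I01) = 1 by rewrite lebesgue_measure_itv /= lte_fin ltr01 /= subr0.
have -> : K = \int[mu]_(t in I01) K by rewrite Rintegral_cst // muI mulr1.
apply: le_Rintegral => //.
- by move: (intf) => /integrable_norm.
- apply: continuous_compact_integrable; first exact: segment_compact.
  by apply: continuous_subspaceT => ?; exact: cvg_cst.
- move=> t /I01P t01; rewrite normrM -[leRHS]mul1r.
  case/andP: (t01) => t0 t1.
  by apply: ler_pM => //; [rewrite ger0_norm ?exprn_ge0 // exprn_ile1|exact: fK].
Qed.

(** Supplies the dominating constant for differentiation under the integral and the Lipschitz bounds
    of [continuous_hadamard]. *)
Lemma bounded_on_smaller_ball f (s : R) : (forall y, U y -> {for y, continuous f}) ->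
  s < r -> exists K, forall y, `|a0 - y| <= s -> `|f y| <= K.
Proof.
(* [closed_ballE] needs a positive radius; for [s <= 0] the only possible point is [a0]. *)
move=> cf sr; have [s0|s0] := leP s 0.
  exists `|f a0| => y ys; suff -> : y = a0 by [].
  by apply/esym/eqP; rewrite -subr_eq0 -normr_le0 (le_trans ys).
have cB : compact (closed_ball a0 s).
  apply: bounded_closed_compact; last exact: closed_ball_closed.
  rewrite closed_ballE //; exists (`|a0| + s); split; first exact: num_real.
  move=> M hM y; rewrite /closed_ball_ /= => ys; apply: le_trans (ltW hM).
  have -> : y = a0 - (a0 - y) by rewrite opprB addrC subrK.
  by apply: le_trans (ler_normB _ _) _; rewrite lerD2l.
have [||c _ fc] := @EVT_max_rV R m (fun y => `|f y|) _ _ cB.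
- by exists a0; rewrite closed_ballE //= /closed_ball_ /= subrr normr0 ltW.
- apply: continuous_in_subspaceT => y /set_mem; rewrite closed_ballE // => ys.
  apply: (@continuous_comp _ _ _ f Num.norm); last exact: norm_continuous.
  by apply: cf; rewrite ballE; exact: le_lt_trans ys sr.
by exists `|f c| => y ys; apply: fc; rewrite inE closed_ballE.
Qed.

Lemma is_derive_hadamard n f x i : Ck 1 U f -> U x ->
  is_derive x 'e_i (hadamard n f) (hadamard n.+1 ('D_('e_i) f) x).
Proof.
move=> cf Ux; rewrite -[x in is_derive x](addr0 x) -[X in _ + X](scale0r 'e_i).
apply/is_derive_line.
have [cf0 Df] := cf; have [df [cdf _]] := Df i.
move: (Ux); rewrite ballE => xr.
have aU : `|a0 - a| < r by rewrite -ballE.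
pose rho := (r - `|a0 - x|) / 2; have rho0 : 0 < rho by rewrite divr_gt0 // subr_gt0.
(* All segments from [a] to [x + h *: 'e_i] with [h] between [- rho] and [rho] stay within distance
   [s < r] of [a0], so one bound [K] dominates the derivative of the integrand for all such [h]. *)
pose s := Num.max `|a0 - a| (`|a0 - x| + rho).
have sr : s < r by rewrite gt_max aU /rho /=; lra.
have [K fK] := bounded_on_smaller_ball cdf sr.
have ei1 : `|'e_i : 'rV[R]_m| <= 1.
  by apply/rV_normP => // j; rewrite !mxE normr_nat lern1 leq_b1.
have near_x h : h \in `]- rho, rho[ -> `|a0 - (x + h *: 'e_i)| <= `|a0 - x| + rho.
  rewrite in_itv /= => /andP[h1 h2]; rewrite opprD addrA.
  apply: le_trans (ler_normB _ _) _; rewrite lerD2l normrZ.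
  have hr : `|h| <= rho by rewrite ler_norml !ltW.
  by rewrite -[rho]mulr1; apply: ler_pM.
have near_U h : h \in `]- rho, rho[ -> U (x + h *: 'e_i).
  by move=> /near_x hx; rewrite ballE (le_lt_trans hx) // /rho; lra.
have near_s h t : h \in `]- rho, rho[ -> 0 <= t <= 1 ->
    `|a0 - (a + t *: (x + h *: 'e_i - a))| <= s.
  move=> hI; apply: ball_segment; first by rewrite le_max lexx.
  by rewrite le_max near_x ?orbT.
pose phi (h t : R) := t ^+ n * f (a + t *: (x + h *: 'e_i - a)).
have dphi h t : h \in `]- rho, rho[ -> 0 <= t <= 1 ->
    is_derive h 1 (phi ^~ t) (t ^+ n.+1 * 'D_('e_i) f (a + t *: (x + h *: 'e_i - a))).
  move=> hI t01; have zE k : a + t *: (x + k *: 'e_i - a) = (a + t *: (x - a)) + (k * t) *: 'e_i.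
    by apply/rowP => j; rewrite !mxE; ring.
  have Uz : U (a + t *: (x - a) + (h * t) *: 'e_i) by rewrite -zE; apply: Useg => //;
    exact: near_U.
  have dline : is_derive (h * t) 1 (fun k => f (a + t *: (x - a) + k *: 'e_i))
      ('D_('e_i) f (a + t *: (x - a) + (h * t) *: 'e_i)).
    by apply/is_derive_line; apply: DeriveDef => //; exact: df.
  have dmul : is_derive h 1 (fun k : R => k * t) t.
    have := is_deriveM (is_derive_id h 1) (is_derive_cst t h 1).
    by rewrite scaler0 add0r /cst [_ *: 1]mulr1.
  have dc := @is_derive1_comp R (fun k => f (a + t *: (x - a) + k *: 'e_i))
    (fun k => k * t) h _ _ dline dmul.
  have -> : phi ^~ t = t ^+ n *: ((fun k => f (a + t *: (x - a) + k *: 'e_i)) \o (fun k => k * t)).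
    by apply/funext => k; rewrite /phi zE.
  apply: (is_derive_eq (is_deriveZ _ dc)); rewrite zE exprS.
  have scaleE (u v : R) : u *: v = u * v by [].
  by rewrite scaleE; ring.
have I0 : (0 : R) \in `]- rho, rho[ by rewrite in_itv /= oppr_lt0 rho0.
have kI k : k \in `]- rho, rho[ -> mu.-integrable I01 (EFin \o phi k).
  by move=> /near_U Uk; exact: (int_seg n cf0 Uk).
have d1 h t : (- rho < h < rho) -> 0 <= t <= 1 ->
    partial1of2 phi h t = t ^+ n.+1 * 'D_('e_i) f (a + t *: (x + h *: 'e_i - a)).
  by move=> hI t01; rewrite partial1of2E; have [] := dphi h t; rewrite ?in_itv.
have lim : h^-1 *: (hadamard n f (x + (h + 0) *: 'e_i) - hadamard n f (x + 0 *: 'e_i))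
    @[h --> (0:R)^'] --> \int[mu]_(t in I01) partial1of2 phi 0 t.
  apply: (@cvg_differentiation_under_integral R _ _ mu phi I01 _ 0 (- rho) rho I0 kI _
    (fun=> `|K|)) => //.
  - by move=> h t hI /I01P t01; have [] := dphi h t hI t01.
  - apply: continuous_compact_integrable; first exact: segment_compact.
    by apply: continuous_subspaceT => ?; exact: cvg_cst.
  - move=> h t hI /I01P t01; have hI' : - rho < h < rho by move: hI;
      rewrite /= in_itv.
    rewrite d1 // normrM -[leRHS]mul1r; case/andP: (t01) => t0 t1.
    apply: ler_pM => //; first by rewrite ger0_norm ?exprn_ge0 // exprn_ile1.
    by apply: le_trans (ler_norm _); apply: fK; exact: near_s.
rewrite (_ : hadamard _ _ _ = \int[mu]_(t in I01) partial1of2 phi 0 t); last first.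
  apply: eq_Rintegral => t /set_mem/I01P t01;
    have r0r : - rho < 0 < rho by rewrite oppr_lt0 rho0.
  by rewrite d1 // scale0r addr0.
have E : (fun h : R => h^-1 *: (hadamard n f (x + (h + 0) *: 'e_i) - hadamard n f (x + 0 *: 'e_i)))
  = (fun h : R => h^-1 *: (((fun s => hadamard n f (x + s *: 'e_i)) \o shift 0) (h *: (1:R)) -
        hadamard n f (x + 0 *: 'e_i))).
  by apply/funext => h /=; rewrite scaler1.
rewrite E in lim.
by apply: DeriveDef; [apply/cvg_ex; eexists; exact: lim|exact: cvg_lim].
Qed.

(** The existence of partial derivatives does not by itself give continuity. Here they are bounded
    on a smaller ball around [a0], and [mean_value_ball] turns the bounds into a Lipschitz estimate
    at [x]. *)
Lemma continuous_hadamard n f x : Ck 2 U f -> U x -> {for x, continuous (hadamard n f)}.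
Proof.
move=> cf Ux; have cf1 := CkW cf.
have dH y j : U y -> is_derive y 'e_j (hadamard n f) (hadamard n.+1 ('D_('e_j) f) y).
  exact: is_derive_hadamard.
pose s := (Num.max `|a0 - a| `|a0 - x| + r) / 2.
have [as_ xs sr] : [/\ `|a0 - a| <= s, `|a0 - x| < s & s < r].
  have aU : `|a0 - a| < r by rewrite -ballE.
  move: (Ux); rewrite ballE => xr.
  have h1 : `|a0 - a| <= Num.max `|a0 - a| `|a0 - x| by rewrite le_max lexx.
  have h2 : `|a0 - x| <= Num.max `|a0 - a| `|a0 - x| by rewrite le_max lexx orbT.
  have h3 : Num.max `|a0 - a| `|a0 - x| < r by rewrite gt_max aU.
  by rewrite /s; split; lra.
have bK j : exists K, forall y, `|a0 - y| <= s -> `|'D_('e_j) f y| <= K.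
  by apply: bounded_on_smaller_ball => //; have [_ /(_ j)[_ [+ _]]] := cf.
have [K hK] := choice bK.
have dHK j y : `|a0 - y| < s -> `|'D_('e_j) (hadamard n f) y| <= K j.
  move=> ys; have Uy : U y by rewrite ballE (lt_trans ys).
  have [_ ->] := dH y j Uy; apply: hadamard_bound => //.
    by have [_ /(_ j)[_ [+ _]]] := cf.
  by move=> t t01; apply: hK; apply: ball_segment => //; exact: ltW.
apply/(@cvgrPdist_le _ _ _ (nbhs x) (nbhs_filter x)) => e e0.
have xsB : ball a0 s x by rewrite -ball_normE.
pose S := \sum_j K j; pose S1 := `|S| + 1; have S10 : 0 < S1 by rewrite ltr_wpDl.
have n1 : \forall y \near x, ball a0 s y by apply: open_nbhs_nbhs; split => //;
  exact: ball_open.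
have n2 : \forall y \near x, `|x - y| <= e / S1.
  apply/nbhs_ballP; exists (e / S1) => /=; first exact: divr_gt0.
  by move=> y; rewrite -ball_normE => /ltW.
near=> y; have ys : ball a0 s y by near: y; exact: n1.
have yx : `|x - y| <= e / S1 by near: y; exact: n2.
have [|xi [xi1 xi2]] := @mean_value_ball R m (hadamard n f) a0 x y s _ xsB ys.
  move=> z j; rewrite -ball_normE /= => zs; have [|//] := dH z j.
  by rewrite ballE (lt_trans zs).
rewrite distrC xi2; apply: le_trans (ler_norm_sum _ _ _) _.
apply: (@le_trans _ _ (\sum_j K j * (e / S1))).
  apply: ler_sum => j _; rewrite normrM; apply: ler_pM => //.
    by apply: dHK; have [+ _] := xi1 j; rewrite -ball_normE.
  have /rV_normP/(_ j) := yx; rewrite !mxE distrC; apply.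
  by rewrite divr_ge0 ?ltW.
rewrite -mulr_suml -/S mulrA ler_pdivrMr // mulrC ler_pM2l //.
by rewrite (le_trans (ler_norm _)) // lerDl.
Unshelve. all: by end_near. Qed.

Lemma Ck_hadamard k n f : smooth_on U f -> Ck k U (hadamard n f).
Proof.
have oU : open U by exact: ball_open.
elim: k n f => [|k IH] n f sf; split=> //.
1,2: by move=> x Ux; exact: continuous_hadamard (sf 2%N) Ux.
move=> i; split=> [x Ux|]; first by have [] := is_derive_hadamard n i (sf 1%N) Ux.
apply: (Ck_eq oU _ (IH n.+1 ('D_('e_i) f) _)) => [x Ux|k'].
  by have [_ ->] := is_derive_hadamard n i (sf 1%N) Ux.
by have [_ /(_ i)[]] := sf k'.+1.
Qed.

(** The fundamental theorem of calculus for [f] along the segment from [a] to [x]. *)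
Lemma hadamard_expansion f x : Ck 1 U f -> U x ->
  f x - f a = \sum_j (x 0 j - a 0 j) * hadamard 0 ('D_('e_j) f) x.
Proof.
move=> cf Ux; have oU : open U by exact: ball_open.
pose gam (t : R) := a + t *: (x - a).
pose dF t := \sum_j 'D_('e_j) f (gam t) * (x 0 j - a 0 j).
have dgam (t : R) j : is_derive t 1 (fun t => gam t 0 j) (x 0 j - a 0 j).
  have -> : (fun t => gam t 0 j) = (fun t => a 0 j + t *: (x 0 j - a 0 j)).
    by apply/funext => u; rewrite !mxE.
  apply/(@is_derive_line R R id); exact: is_derive_id.
have dFP (t : R) : 0 <= t <= 1 -> is_derive t 1 (f \o gam) (dF t).
  by move=> t01; apply: (is_derive_chain oU cf _ (dgam t)); exact: Useg.
have cD j y : U y -> {for y, continuous ('D_('e_j) f)}.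
  by have [_ /(_ j)[_ [+ _]]] := cf; apply.
have cgam : continuous gam.
  by move=> t; apply: cvgD; [exact: cvg_cst|apply: cvgZl; exact: cvg_id].
have cF (t : R) : 0 <= t <= 1 -> {for t, continuous (f \o gam)}.
  move=> t01; apply: differentiable_continuous; apply/derivable1_diffP.
  by have [] := dFP t t01.
have cdF : {within I01, continuous dF}.
  apply: continuous_in_subspaceT => t /set_mem/I01P t01.
  apply: cvg_big => [|j _]; first exact: add_continuous.
  apply: cvgM; last exact: cvg_cst.
  apply: (@continuous_comp _ _ _ gam ('D_('e_j) f)); first exact: cgam.
  by apply: cD; exact: Useg.
have /(congr1 fine) : (\int[mu]_(t in `[0%R, 1%R]) (dF t)%:E = ((f \o gam) 1)%:E - ((f \o
  gam) 0)%:E)%E.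
  apply: continuous_FTC2 => //.
  - split.
    + move=> t; rewrite in_itv /= => /andP[t0 t1].
      by have [] := dFP t; rewrite ?ltW.
    + by apply: cvg_at_right_filter; apply: cF; rewrite lexx ler01.
    + by apply: cvg_at_left_filter; apply: cF; rewrite lexx ler01.
  - move=> t; rewrite in_itv /= => /andP[t0 t1]; rewrite derive1E.
    have t01 : 0 <= t <= 1 by rewrite !ltW.
    by have [_ ->] := dFP t t01.
have gam0 : gam 0 = a by rewrite /gam scale0r addr0.
have gam1 : gam 1 = x by rewrite /gam scale1r addrC subrK.
rewrite /= gam0 gam1 => <-.
rewrite -[LHS]/(\int[mu]_(t in I01) dF t).
have intj j : mu.-integrable I01 (EFin \o (fun t => 'D_('e_j) f (gam t))).
  have := int_seg 0 (cD j) Ux; congr (_.-integrable _ (_ \o _)).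
  by apply/funext => t; rewrite expr0 mul1r.
have intM j : mu.-integrable I01
    (EFin \o (fun t => 'D_('e_j) f (gam t) * (x 0 j - a 0 j))).
  apply: eq_integrable (integrableZl _ (x 0 j - a 0 j) (intj j)) => //.
  by move=> t _; rewrite /= -EFinM mulrC.
suff sumP (s : seq 'I_m) :
    mu.-integrable I01 (EFin \o (fun t => \sum_(j <- s) 'D_('e_j) f (gam t) * (x 0 j - a 0 j))) /\
    \int[mu]_(t in I01) (\sum_(j <- s) 'D_('e_j) f (gam t) * (x 0 j - a 0 j)) =
    \sum_(j <- s) (x 0 j - a 0 j) * hadamard 0 ('D_('e_j) f) x.
  exact: (sumP _).2.
elim: s => [|j s [IH1 IH2]].
  rewrite big_nil; have -> : (fun t : R => \sum_(j <- [::]) 'D_('e_j) f (gam t) * (x 0 j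
    - a 0 j)) = (fun=> 0).
    by apply/funext => t; rewrite big_nil.
  by split; [exact: integrable0|rewrite Rintegral_cst // mul0r].
have -> : (fun t : R => \sum_(k <- j :: s) 'D_('e_k) f (gam t) * (x 0 k - a 0 k)) =
    (fun t => 'D_('e_j) f (gam t) * (x 0 j - a 0 j) +
       \sum_(k <- s) 'D_('e_k) f (gam t) * (x 0 k - a 0 k)).
  by apply/funext => t; rewrite big_cons.
split.
  by apply: eq_integrable (integrableD _ (intM j) IH1).
rewrite RintegralD // IH2 big_cons; congr (_ + _).
rewrite RintegralZr // mulrC; congr (_ * _).
by apply: eq_Rintegral => t _; rewrite expr0 mul1r.
Qed.
End Hadamard.

(** Applied to partial derivatives: at the expansion point, the coefficients of Hadamard's expansion
    are the partial derivatives themselves. *)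
Lemma hadamard_center (R : realType) (m : nat) (a : 'rV[R]_m) f : hadamard a 0 f a = f a.
Proof.
have muI : fine (@lebesgue_measure R `[0, 1]) = 1.
  by rewrite lebesgue_measure_itv /= lte_fin ltr01 /= subr0.
rewrite -[RHS]mulr1 -[X in _ = _ * X]muI -Rintegral_cst //.
by apply: eq_Rintegral => t _; rewrite expr0 mul1r subrr scaler0 addr0.
Qed.

(** * Local frames *)

Section ChartExtension.
Variables (R : realType) (m : nat) (M : manifold R m).
Local Notation C := (smoothFun M).
Local Notation V := (vectorField M).

Lemma open_chart_preimage (c : chart R M m) (P : set M) : open P ->
  open (chart_img c `&` chart_inv c @^-1` P).
Proof.
move=> oP; rewrite openE => x [cx Px]; apply: filterI.
  by apply: open_nbhs_nbhs; split=> //; exact: chart_img_open.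
by apply: (chart_inv_cont cx); apply: open_nbhs_nbhs.
Qed.

Variables (c : chart R M m) (a : 'rV[R]_m) (r r' : R).
Hypotheses (Ac : atlas c) (r0 : 0 < r) (rr' : r < r').
Hypothesis (img_r' : ball a r' `<=` chart_img c).

Definition chart_ext (u : 'rV[R]_m -> R) (q : M) : R :=
  if `[< chart_dom c q >] then bump a r (chart_map c q) * u (chart_map c q) else 0.

Lemma chart_ext_in u q : chart_dom c q ->
  chart_ext u q = bump a r (chart_map c q) * u (chart_map c q).
Proof. by move=> cq; rewrite /chart_ext asboolT. Qed.

Lemma chart_ext_out u q : ~ chart_dom c q -> chart_ext u q = 0.
Proof. by move=> cq; rewrite /chart_ext asboolF. Qed.

(** Near a point of [K], the image of the closed ball of radius [r], this is a product of smooth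
    functions, because [u] is smooth up to the larger radius [r']. Off [K] it vanishes, and the
    complement of [K] is open since [K] is compact and [M] is Hausdorff. *)
Lemma chart_ext_smooth u : smooth_on (ball a r') u -> smooth (chart_ext u).
Proof.
move=> su c' Ac' k; apply: Ck_local => x c'x.
have oW0 := open_chart_preimage (c := c') (chart_dom_open c).
pose G x := chart_map c (chart_inv c' x).
pose K := chart_inv c @` closed_ball a r.
have Kimg y : closed_ball a r y -> chart_img c y.
  rewrite closed_ballE // /closed_ball_ /= => ay; apply: img_r'.
  by rewrite -ball_normE /= (le_lt_trans ay).
have cK : closed K.
  apply: (compact_closed (@manifold_hausdorff _ _ M)).
  apply: continuous_compact.
    by apply: continuous_in_subspaceT => y /set_mem/Kimg; exact: chart_inv_cont.
  apply: bounded_closed_compact; last exact: closed_ball_closed.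
  rewrite closed_ballE //; exists (`|a| + r); split; first exact: num_real.
  move=> N hN y; rewrite /closed_ball_ /= => ys; apply: le_trans (ltW hN).
  have -> : y = a - (a - y) by rewrite opprB addrC subrK.
  by apply: le_trans (ler_normB _ _) _; rewrite lerD2l.
have [[y yB yx]|nK] := pselect (K (chart_inv c' x)).
- exists ((chart_img c' `&` chart_inv c' @^-1` chart_dom c) `&` G @^-1` ball a r').
  have cG z : (chart_img c' `&` chart_inv c' @^-1` chart_dom c) z -> {for z, continuous G}.
    move=> [c'z cz]; apply: (@continuous_comp _ _ _ (chart_inv c') (chart_map c)).
      exact: chart_inv_cont.
    exact: chart_map_cont.
  have oW : open ((chart_img c' `&` chart_inv c' @^-1` chart_dom c) `&` G @^-1` ball a r').
    rewrite openE => z [W0z Gz]; apply: filterI; first exact: open_nbhs_nbhs.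
    by apply: (cG z W0z); apply: open_nbhs_nbhs; split=> //; exact: ball_open.
  split=> //.
    have cy := Kimg _ yB; split; first by split=> //=; rewrite -yx;
      exact: chart_inv_dom.
    rewrite /G /= -yx chart_invK //.
    move: yB; rewrite closed_ballE // /closed_ball_ -ball_normE /=.
    by move=> ay; exact: le_lt_trans ay rr'.
  have oB : open (ball a r') by exact: ball_open.
  have cu : Ck k (ball a r') (fun z => bump a r z * u z).
    by apply: CkM => //; exact: Ck_bump.
  have cGj j : Ck k ((chart_img c' `&` chart_inv c' @^-1` chart_dom c) `&` G @^-1` ball a r')
      (fun z => G z 0 j).
    by apply: Ck_sub (atlas_compatible Ac' Ac j k) => z [].
  have GB z : ((chart_img c' `&` chart_inv c' @^-1` chart_dom c) `&` G @^-1` ball a r') z ->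
      ball a r' (G z) by case.
  apply: (Ck_eq oW _ (Ck_comp oB oW GB cGj cu)) => z [[_ cz] _].
  by rewrite /= chart_ext_in.
- exists (chart_img c' `&` chart_inv c' @^-1` (~` K)).
  have oW := open_chart_preimage (c := c') (closed_openC cK).
  split=> //; apply: (Ck_eq oW _ (Ck_cst k _ 0)) => z [c'z nKz] /=.
  have [cz|cz] := pselect (chart_dom c (chart_inv c' z));
    last by rewrite chart_ext_out.
  rewrite chart_ext_in // bump_eq0 ?mul0r // => zB; apply: nKz.
  exists (chart_map c (chart_inv c' z)); last by rewrite chart_mapK.
  by move: zB; rewrite closed_ballE // -ball_normE => /ltW.
Qed.

End ChartExtension.

Section LocalFrame.
Variables (R : realType) (m : nat) (M : manifold R m).
Local Notation C := (smoothFun M).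
Local Notation V := (vectorField M).
Implicit Types (f : C) (Z : V).

Lemma vf_cst Z (k : R) : Z (k *: (1 : C)) = 0.
Proof.
have -> : Z (k *: (1 : C)) = k *: Z 1 by exact: linearZ.
suff -> : Z 1 = 0 by rewrite scaler0.
have := vf_leibniz Z 1 1; rewrite !mulr1 mul1r => /eqP.
by rewrite eq_sym -subr_eq0 addrK => /eqP.
Qed.

Section Frame.
Variables (c : chart R M m) (a : 'rV[R]_m) (r r' : R).
Hypotheses (Ac : atlas c) (r0 : 0 < r) (rr' : r < r').
Hypothesis (img_r' : ball a r' `<=` chart_img c).

Let oB : open (ball a r'). Proof. exact: ball_open. Qed.

Definition ext_fun u (su : smooth_on (ball a r') u) : C :=
  SmoothFun (chart_ext_smooth Ac r0 rr' img_r' su).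

Let smooth_pull f : smooth_on (ball a r') (f \o chart_inv c).
Proof. by move=> k; apply: Ck_sub img_r' _; exact: sf_smooth. Qed.

Let smooth_partial f i : smooth_on (ball a r') ('D_('e_i) (f \o chart_inv c)).
Proof. by move=> k; have [_ /(_ i)[]] := smooth_pull f k.+1. Qed.

Definition coord_field_fun i f : C := ext_fun (smooth_partial f i).

Let derivable_pull f i x : ball a r' x -> derivable (f \o chart_inv c) x 'e_i.
Proof. by have [_ /(_ i)[+ _]] := smooth_pull f 1%N; exact. Qed.

Let sub_ball x : ball a r x -> ball a r' x.
Proof. by apply: le_ball; exact: ltW. Qed.

(** Quantified over [u] inside each case because an identity usually involves several extensions,
    and all of them vanish together. *)
Lemma chart_ext_cases q (P : Prop) :
  ((forall u, chart_ext c a r u q = 0) -> P) ->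
  (chart_dom c q -> ball a r (chart_map c q) ->
    (forall u, chart_ext c a r u q = bump a r (chart_map c q) * u (chart_map c q)) -> P) ->
  P.
Proof.
move=> out inn; have [cq|cq] := pselect (chart_dom c q); last first.
  by apply: out => u; exact: chart_ext_out.
have [qB|qB] := pselect (ball a r (chart_map c q)).
  by apply: inn => // u; exact: chart_ext_in.
by apply: out => u; rewrite chart_ext_in // bump_eq0 ?mul0r.
Qed.

Fact coord_field_linear i : linear (coord_field_fun i).
Proof.
move=> k f g; apply: sfP => q; rewrite sfDE sfZE /=.
apply: (@chart_ext_cases q) => [out|cq qB inn]; first by rewrite !out mulr0 addr0.
rewrite !inn; have [/sub_ball/derivable_pull df /sub_ball/derivable_pull dg] := (qB, qB).
have -> : (k *: f + g : C) \o chart_inv c =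
    k *: (f \o chart_inv c) + (g \o chart_inv c) by [].
rewrite deriveD; [|exact: derivableZ|exact: dg].
by rewrite deriveZ; [rewrite mulrDr mulrCA|exact: df].
Qed.

Fact coord_field_leibniz i f g :
  coord_field_fun i (f * g) = coord_field_fun i f * g + f * coord_field_fun i g.
Proof.
apply: sfP => q; rewrite sfDE !sfME /=.
apply: (@chart_ext_cases q) => [out|cq qB inn];
  first by rewrite !out mul0r mulr0 addr0.
rewrite !inn; have [/sub_ball/derivable_pull df /sub_ball/derivable_pull dg] := (qB, qB).
have -> : (f * g : C) \o chart_inv c = (f \o chart_inv c) * (g \o chart_inv c) by [].
rewrite deriveM; [|exact: df|exact: dg].
by rewrite /= chart_mapK // ![_ *: _]mulrC; ring.
Qed.

Definition coord_field i : V := VectorField (coord_field_linear i) (coord_field_leibniz i).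

Let smooth_coord j : smooth_on (ball a r') (fun x : 'rV[R]_m => x 0 j).
Proof. by move=> k; exact: Ck_coord. Qed.

Let smooth_one : smooth_on (ball a r') (fun _ : 'rV[R]_m => 1).
Proof. by move=> k; exact: Ck_cst. Qed.

Definition cutoff : C := ext_fun smooth_one.
Definition cut_coord j : C := ext_fun (smooth_coord j).
(** The numerator of the quotient rule for [cut_coord j / cutoff], that is, [cutoff ^+ 2] times the
    value of [Z] on the [j]-th coordinate, which is not a global function. The third cutoff in the
    next lemma is the one inside [coord_field j]. *)
Definition field_coef Z j : C := cutoff * Z (cut_coord j) - cut_coord j * Z cutoff.

Lemma coord_field_expansion Z f :
  cutoff ^+ 3 * Z f = \sum_j field_coef Z j * coord_field j f.
Proof.
apply: sfP => q.
have sumE (F : 'I_m -> C) : (\sum_j F j) q = \sum_j F j q.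
  by elim/big_rec2: _ => // j x y _ <-.
rewrite sumE; apply: (@chart_ext_cases q) => [out|cq qB inn].
  rewrite exprS !sfME /= out !mul0r; apply/esym/big1 => j _.
  by rewrite /= !out mulr0.
set b := chart_map c q in qB inn.
have bB : ball a r' b := sub_ball qB.
pose F := f \o chart_inv c.
have sH j : smooth_on (ball a r') (hadamard b 0 ('D_('e_j) F)).
  by move=> k; apply: Ck_hadamard => //; exact: smooth_partial.
pose H j : C := ext_fun (sH j).
(* Hadamard's expansion about [q], with one cutoff for [x_j - b_j] and one for its coefficient to
   make both sides global. After applying [Z] and evaluating at [q], the Leibniz terms with an
   undifferentiated [f - f q] or [x_j - b_j] vanish. *)
have E : cutoff * cutoff * (f - f q *: (1 : C)) = \sum_j (cut_coord j - b 0 j *: cutoff) * H j.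
  apply: sfP => q'.
  have -> : (\sum_j (cut_coord j - b 0 j *: cutoff) * H j) q' =
      \sum_j ((cut_coord j - b 0 j *: cutoff) * H j) q'.
    by elim/big_rec2: _ => // j x y _ <-.
  apply: (@chart_ext_cases q') => [out|cq' qB' inn'].
    rewrite !sfME /= out !mul0r; apply/esym/big1 => j _.
    by rewrite /= !out mulr0.
  rewrite !sfME /= !inn' !mulr1.
  have <- : F (chart_map c q') = f q' by rewrite /F /= chart_mapK.
  have <- : F b = f q by rewrite /F /= chart_mapK.
  rewrite (hadamard_expansion bB (smooth_pull f 1%N)); last exact: sub_ball.
  rewrite mulr_sumr; apply: eq_bigr => j _.
  by rewrite /= !inn' /F; ring.
have := congr1 (fun h : C => h q) (congr1 Z E).
have -> : Z (\sum_j (cut_coord j - b 0 j *: cutoff) * H j) =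
    \sum_j Z ((cut_coord j - b 0 j *: cutoff) * H j) by exact: linear_sum.
rewrite sumE vf_leibniz !sfDE !sfME /= inn.
have -> : Z (f - f q *: (1 : C)) = Z f.
  by rewrite -[LHS]/(Z _) (linearB Z) /= vf_cst subr0.
rewrite !mulr1 subrr mulr0 add0r => ZE; rewrite -mulrA ZE mulr_sumr.
apply: eq_bigr => j _; rewrite vf_leibniz !sfDE !sfME /= !inn hadamard_center !mulr1.
have -> : Z (cut_coord j - b 0 j *: cutoff) = Z (cut_coord j) - b 0 j *: Z cutoff.
  by rewrite -[LHS]/(Z _) (linearB Z) (linearZ_LR Z).
by rewrite /=; ring.
Qed.

(** As [x_j - b_j] vanishes at the point, no derivative of the bump survives; one factor of the
    square comes from the cut-off function, the other from the cut-off field. *)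
Lemma coord_field_coord i j q : chart_dom c q -> ball a r (chart_map c q) ->
  coord_field i (cut_coord j - chart_map c q 0 j *: cutoff) q =
  (bump a r (chart_map c q)) ^+ 2 * (i == j)%:R.
Proof.
move=> cq qB; rewrite expr2 -mulrA /= chart_ext_in //; congr (_ * _).
set b := chart_map c q in qB *.
have near_E : {near b, (fun x => bump a r x * (x 0 j - b 0 j)) =1
    (cut_coord j - b 0 j *: cutoff : C) \o chart_inv c}.
  have nB : \forall x \near b, ball a r x by apply: open_nbhs_nbhs; split => //;
    exact: ball_open.
  apply: (@filterS _ (nbhs b) _ _ _ _ nB) => x xB.
  have cx := img_r' (sub_ball xB).
  by rewrite /= !chart_ext_in ?chart_invK //; [ring|exact: chart_inv_dom..].
rewrite -(near_eq_derive _ near_E).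
have db : derivable (bump a r) b 'e_i.
  by have [_ /(_ i)[+ _]] := Ck_bump 1 a r oB; apply; exact: sub_ball.
have dc : is_derive b 'e_i (fun x : 'rV[R]_m => x 0 j - b 0 j) (('e_i : 'rV[R]_m) 0 j).
  by rewrite -[X in is_derive _ _ _ X]subr0; apply: is_deriveB;
    exact: is_derive_coord.
have [dc1 dc2] := dc.
by rewrite deriveM // dc2 subrr scale0r addr0 mxE eqxx eq_sym.
Qed.

End Frame.

(* Multiplying by the cutoff turns the chart coordinates into global functions, and
   the field [Z] is recovered from its values on them by Hadamard's lemma. *)
Lemma local_frame (p : M) : exists (E : 'I_m -> V) (h : C) (x : 'I_m -> C) (e : R),
  [/\ h p != 0, e != 0, forall i j, E i (x j) p = e * (i == j)%:R &
    forall Z, exists z : 'I_m -> C, h *: Z = \sum_j z j *: E j].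
Proof.
have [c Ac cp] := atlas_cover p.
pose a := chart_map c p.
have [r' /= r'0 img] : exists2 r', 0 < r' & ball a r' `<=` chart_img c.
  have : nbhs a (chart_img c).
    by apply: open_nbhs_nbhs; split; [exact: chart_img_open|exact: chart_map_img].
  by move=> /nbhs_ballP[r' r'0 sub]; exists r'.
have r0 : 0 < r' / 2 by rewrite divr_gt0.
have rr' : r' / 2 < r' by lra.
have aB : ball a (r' / 2) a by exact: ballxx.
have b0 : bump a (r' / 2) a != 0 by rewrite gt_eqF // bump_gt0.
exists (coord_field Ac r0 rr' img), (cutoff Ac r0 rr' img ^+ 3),
  (fun j => cut_coord Ac r0 rr' img j - a 0 j *: cutoff Ac r0 rr' img),
  (bump a (r' / 2) a ^+ 2); split.
- by rewrite !exprS !sfME expr0 /= chart_ext_in // !mulr1 !mulf_neq0.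
- by rewrite expf_neq0.
- by move=> i j; exact: coord_field_coord.
- move=> Z; exists (field_coef Ac r0 rr' img Z); apply: vfP => f.
  rewrite vfZE coord_field_expansion.
  by elim/big_rec2: _ => // j x y _ ->; rewrite vfDE vfZE.
Qed.

End LocalFrame.

(** * Metric duality *)

Section Evaluation.
Variables (R : realType) (m : nat) (M : manifold R m).

(** Named in order to carry a ring morphism structure, through which determinants and sums of
    functions are evaluated at a point. *)
Definition eval_at (p : M) (f : smoothFun M) : R := f p.

Fact eval_at_additive p : zmod_morphism (eval_at p).
Proof. by move=> f g; rewrite /eval_at sfDE sfNE. Qed.

Fact eval_at_multiplicative p : monoid_morphism (eval_at p).
Proof. by split=> [|f g]; rewrite /eval_at ?sf1E ?sfME. Qed.

HB.instance Definition _ p :=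
  GRing.isZmodMorphism.Build (smoothFun M) R (eval_at p) (eval_at_additive p).
HB.instance Definition _ p :=
  GRing.isMonoidMorphism.Build (smoothFun M) R (eval_at p) (eval_at_multiplicative p).

Lemma sf_sumE (I : Type) (s : seq I) (F : I -> smoothFun M) p :
  (\sum_(i <- s) F i) p = \sum_(i <- s) F i p.
Proof. exact: (raddf_sum (eval_at p)). Qed.

Lemma vf_sumE (I : Type) (s : seq I) (F : I -> vectorField M) f :
  (\sum_(i <- s) F i) f = \sum_(i <- s) F i f.
Proof. by elim/big_rec2: _ => // i x y _ <-; rewrite vfDE. Qed.

End Evaluation.

Section ScalarMap.
Variables (R : realType) (m : nat) (M : manifold R m).
Local Notation C := (smoothFun M).
Local Notation V := (vectorField M).
Variables (alpha : V -> C) (lin : scalar alpha).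
Implicit Types (X Y : V) (f : C).

Lemma formD X Y : alpha (X + Y) = alpha X + alpha Y.
Proof. by have := lin 1 X Y; rewrite scale1r mul1r. Qed.

Lemma form0 : alpha 0 = 0.
Proof. by have /(congr1 (fun f => f - alpha 0)) := formD 0 0;
  rewrite addr0 subrr addrK. Qed.

Lemma formZ f X : alpha (f *: X) = f * alpha X.
Proof. by have := lin f X 0; rewrite form0 !addr0. Qed.

Lemma formN X : alpha (- X) = - alpha X.
Proof. by rewrite -scaleN1r formZ mulN1r. Qed.

Lemma formB X Y : alpha (X - Y) = alpha X - alpha Y.
Proof. by rewrite formD formN. Qed.

Lemma form_sum (I : Type) (s : seq I) (F : I -> V) :
  alpha (\sum_(i <- s) F i) = \sum_(i <- s) alpha (F i).
Proof. by apply: big_morph; [exact: formD|exact: form0]. Qed.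

End ScalarMap.

Section Musical.
Variables (R : realType) (m : nat) (M : manifold R m) (g : riemannianMetric M).
Local Notation C := (smoothFun M).
Local Notation V := (vectorField M).
Implicit Types (X Y Z : V) (f : C) (alpha : V -> C).

Lemma metricC X Y : g X Y = g Y X. Proof. exact: metric_sym. Qed.
Lemma metricDr X Y Z : g X (Y + Z) = g X Y + g X Z.
Proof. exact: (formD (metric_linear g X)). Qed.
Lemma metricDl X Y Z : g (X + Y) Z = g X Z + g Y Z.
Proof. by rewrite metricC metricDr !(metricC Z). Qed.
Lemma metricZr X f Y : g X (f *: Y) = f * g X Y.
Proof. exact: (formZ (metric_linear g X)). Qed.
Lemma metricZl X f Y : g (f *: X) Y = f * g X Y.
Proof. by rewrite metricC metricZr metricC. Qed.
Lemma metricNr X Y : g X (- Y) = - g X Y.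
Proof. exact: (formN (metric_linear g X)). Qed.
Lemma metricNl X Y : g (- X) Y = - g X Y.
Proof. by rewrite metricC metricNr metricC. Qed.
Lemma metric0r X : g X 0 = 0.
Proof. exact: (form0 (metric_linear g X)). Qed.
Lemma metric0l X : g 0 X = 0.
Proof. by rewrite metricC metric0r. Qed.
Lemma metric_sumr X (I : Type) (s : seq I) (F : I -> V) :
  g X (\sum_(i <- s) F i) = \sum_(i <- s) g X (F i).
Proof. exact: (form_sum (metric_linear g X)). Qed.
Lemma metric_suml X (I : Type) (s : seq I) (F : I -> V) :
  g (\sum_(i <- s) F i) X = \sum_(i <- s) g (F i) X.
Proof. by rewrite metricC metric_sumr; apply: eq_bigr => i _; rewrite metricC. Qed.

Lemma metric_definite X : g X X = 0 -> X = 0.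
Proof.
move=> gX; apply: vfP => f; apply: sfP => p; apply/eqP/negPn/negP => Xf.
by have := metric_pos g (ex_intro _ f Xf); rewrite gX sf0E ltxx.
Qed.

Lemma metric_inj X Y : (forall Z, g X Z = g Y Z) -> X = Y.
Proof.
move=> XY; apply/eqP; rewrite -subr_eq0; apply/eqP/metric_definite.
by rewrite metricDl metricNl XY subrr.
Qed.

Lemma frame_combination_neq0 (E : 'I_m -> V) (x : 'I_m -> C) (e : R) p (v : 'rV[R]_m) :
  e != 0 -> (forall i j, E i (x j) p = e * (i == j)%:R) -> v != 0 ->
  exists f, (\sum_i (v 0 i *: (1 : C)) *: E i) f p != 0.
Proof.
move=> e0 Ex /rV0Pn[j vj]; exists (x j); rewrite vf_sumE sf_sumE.
rewrite (bigD1 j) //= big1 ?addr0 => [|i ij].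
  by rewrite Ex eqxx !mulr1 mulf_neq0.
by rewrite Ex (negbTE ij) !mulr0.
Qed.

(* [B = sum_i (alpha(E_j) adj(G)_ji) E_i] for the Gram matrix [G] of a local frame. *)
Lemma musical_local alpha p : scalar alpha ->
  exists (B : V) (d : C), d p != 0 /\ forall Z, g B Z = d * alpha Z.
Proof.
move=> lin; have [E [h [x [e [hp e0 Ex hZ]]]]] := local_frame p.
pose G : 'M[C]_m := \matrix_(i, j) g (E i) (E j).
pose av : 'rV[C]_m := \row_j alpha (E j).
pose b : 'rV[C]_m := av *m \adj G.
pose B := \sum_i b 0 i *: E i.
have gB k : g B (E k) = \det G * alpha (E k).
  rewrite metric_suml; have : (b *m G) 0 k = \det G * alpha (E k).
    by rewrite /b -mulmxA mul_adj_mx mul_mx_scalar !mxE.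
  by rewrite mxE => <-; apply: eq_bigr => i _; rewrite metricZl [G i k]mxE.
exists (h *: B), (\det G * h); split; last first.
  move=> Z; rewrite metricZl -metricZr -mulrA -(formZ lin); have [z ->] := hZ Z.
  rewrite metric_sumr (form_sum lin) mulr_sumr.
  by apply: eq_bigr => j _; rewrite metricZr (formZ lin) gB mulrCA.
(* If the Gram determinant vanished at [p], a kernel vector would give a constant combination [W] of
   the frame that is nonzero at [p] but has length [0] there. *)
rewrite sfME mulf_neq0 //; apply/negP => dG.
have /det0P[v v0 vG] : \det (map_mx (eval_at p) G) == 0 by rewrite det_map_mx.
pose W := \sum_i (v 0 i *: (1 : C)) *: E i.
have [f Wf] := frame_combination_neq0 e0 Ex v0.
have := metric_pos g (ex_intro _ f Wf : exists f, W f p != 0).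
suff -> : g W W p = 0 by rewrite ltxx.
rewrite {2}/W metric_sumr sf_sumE big1 // => j _; rewrite metricZr sfME metricC.
have -> : g (E j) W p = (v *m map_mx (eval_at p) G) 0 j; last by rewrite vG mxE mulr0.
rewrite /W metric_sumr sf_sumE mxE; apply: eq_bigr => i _.
by rewrite metricZr sfME !mxE metricC /= mulr1.
Qed.

Lemma exists_dual_field alpha : scalar alpha -> exists A, forall Z, g A Z = alpha Z.
Proof.
move=> lin.
have /choice[B /choice[d Bd]] := fun p => musical_local p lin.
have d0 p : d p p != 0 by have [] := Bd p.
have gB p Z : g (B p) Z = d p * alpha Z by have [_] := Bd p; exact.
have BB p q : d q *: B p = d p *: B q.
  by apply: metric_inj => Z; rewrite !metricZl !gB mulrCA.
have BBE p q f : d p q != 0 -> B q f q / d q q = B p f q / d p q.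
  move=> dpq; apply/eqP; rewrite eqr_div // mulrC [X in _ == X]mulrC.
  by have /(congr1 (fun X : V => X f q)) := BB p q; rewrite !vfZE !sfME => ->.
(* The candidate uses at each point [q] the local field chosen for [q]. By [BBE] it agrees with the
   single quotient of [B p] by [d p] wherever [d p] is nonzero, so it is smooth near [p]. *)
have As f : smooth (fun q => B q f q / d q q).
  move=> c Ac k; apply: Ck_local => x cx.
  pose p := chart_inv c x; pose dp := d p \o chart_inv c.
  have cdp y : chart_img c y -> {for y, continuous dp}.
    by have [+ _] := sf_smooth (d p) Ac 0; exact.
  exists (chart_img c `&` dp @^-1` [set t | t != 0]).
  have oU : open (chart_img c `&` dp @^-1` [set t | t != 0]).
    rewrite openE => y [cy dy]; apply: filterI.
      by apply: open_nbhs_nbhs; split=> //; exact: chart_img_open.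
    by apply: (cdp y cy); apply: open_nbhs_nbhs; split=> //; exact: open_neq.
  split=> //; first by split=> //; exact: d0.
  have cB : Ck k (chart_img c `&` dp @^-1` [set t | t != 0]) (B p f \o chart_inv c).
    by apply: Ck_sub (sf_smooth (B p f) Ac k) => y [].
  have cd : Ck k (chart_img c `&` dp @^-1` [set t | t != 0]) dp.
    by apply: Ck_sub (sf_smooth (d p) Ac k) => y [].
  have ci := Ck_inv oU (fun y Uy => Uy.2) cd.
  by apply: (Ck_eq oU _ (CkM oU cB ci)) => y [_ dy] /=; rewrite (BBE p).
pose A f : C := SmoothFun (As f).
have Alin : linear A.
  move=> k f1 f2; apply: sfP => q.
  by rewrite sfDE sfZE /= (linearP (B q)) sfDE sfZE mulrDl mulrA.
have Aleib f1 f2 : A (f1 * f2) = A f1 * f2 + f1 * A f2.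
  by apply: sfP => q; rewrite sfDE !sfME /= vf_leibniz sfDE !sfME; ring.
exists (VectorField Alin Aleib) => Z; set X := VectorField _ _.
apply: sfP => q.
(* The second factor [d q] makes this an identity on all of [M]: where [d q] vanishes, so do both
   sides. It is cancelled at the point [q] only. *)
have E : d q *: (d q *: X) = d q *: B q.
  apply: vfP => f; apply: sfP => p; rewrite !vfZE !sfME /=.
  have [->|dqp] := eqVneq (d q p) 0; first by rewrite !mul0r.
  by rewrite (BBE q p) //; field.
have := congr1 (fun W => g W Z q) E; rewrite /= !metricZl gB !sfME.
by move=> /(mulfI (d0 q))/(mulfI (d0 q)).
Qed.

(** Constant combinations of a frame that the [eta j] kill at [p] are the kernel of an [m] by [k]
    matrix, nonzero as [k < m]. For the three contact forms this yields a field that is horizontal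
    and nonzero at a given point. *)
Lemma exists_common_kernel (k : nat) (eta : 'I_k -> V -> C) (p : M) : (k < m)%N ->
  (forall j, scalar (eta j)) ->
  exists W : V, (forall j, eta j W p = 0) /\ exists f, W f p != 0.
Proof.
move=> km lin; have [E [h [x [e [hp e0 Ex hZ]]]]] := local_frame p.
pose N : 'M[R]_(m, k) := \matrix_(i, j) eta j (E i) p.
have /rowV0Pn[v /sub_kermxP vN v0] : kermx N != 0.
  rewrite -mxrank_eq0 mxrank_ker subn_eq0 -ltnNge.
  exact: leq_ltn_trans (rank_leq_col N) km.
exists (\sum_i (v 0 i *: (1 : C)) *: E i); split;
  last exact: frame_combination_neq0 Ex v0.
move=> j; rewrite (form_sum (lin j)) sf_sumE.
have : (v *m N) 0 j = 0 by rewrite vN mxE.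
rewrite mxE => vNj; rewrite -[RHS]vNj; apply: eq_bigr => i _.
by rewrite (formZ (lin j)) sfME /= mulr1 mxE.
Qed.

End Musical.

(** * Metric connections with prescribed torsion *)

Section VectorFieldCalculus.
Variables (R : realType) (m : nat) (M : manifold R m).
Local Notation C := (smoothFun M).
Local Notation V := (vectorField M).
Implicit Types (X Y Z : V) (f h : C).

Lemma sf_dbl_inj f h : f + f = h + h -> f = h.
Proof.
move=> fh; apply: sfP => p; have := congr1 (fun k : C => k p) fh.
by rewrite !sfDE -!mulr2n => /eqP; rewrite eqrMn2r => /eqP.
Qed.

Lemma vfN X f : X (- f) = - X f. Proof. exact: linearN. Qed.
Lemma vf0 X : X 0 = 0. Proof. exact: linear0. Qed.
Lemma vf0E f : (0 : V) f = 0. Proof. by []. Qed.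
Lemma vf1 X : X 1 = 0.
Proof. by rewrite -(vf_cst X 1) scale1r. Qed.

Lemma bracketC X Y : bracket X Y = - bracket Y X.
Proof. by apply: vfP => f; rewrite vfNE /= opprB. Qed.
Lemma bracketDl X Y Z : bracket (X + Y) Z = bracket X Z + bracket Y Z.
Proof. by apply: vfP => f; rewrite vfDE /= vfD; ring. Qed.
Lemma bracketDr X Y Z : bracket X (Y + Z) = bracket X Y + bracket X Z.
Proof. by apply: vfP => f; rewrite vfDE /= vfD; ring. Qed.
Lemma bracketZl f X Y : bracket (f *: X) Y = f *: bracket X Y - Y f *: X.
Proof.
by apply: vfP => h; rewrite vfDE vfNE !vfZE /= vf_leibniz; ring.
Qed.
Lemma bracketZr f X Y : bracket X (f *: Y) = f *: bracket X Y + X f *: Y.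
Proof. by rewrite bracketC bracketZl bracketC scalerN opprB opprK addrC. Qed.
Lemma bracketXX X : bracket X X = 0.
Proof. by apply: vfP => f; rewrite /= subrr. Qed.

End VectorFieldCalculus.

Section Connections.
Variables (R : realType) (m : nat) (M : manifold R m) (g : riemannianMetric M).
Local Notation C := (smoothFun M).
Local Notation V := (vectorField M).
Implicit Types (X Y Z : V) (f h : C).

(** Koszul's expression for twice [g(nabla^g_X Y, Z)], with [nabla^g] the Levi-Civita connection. *)
Definition koszul X Y Z : C :=
  X (g Y Z) + Y (g Z X) - Z (g X Y)
  + g (bracket X Y) Z - g (bracket Y Z) X + g (bracket Z X) Y.

Definition metric_bracketE := (metricDl, metricDr, metricNl, metricNr, metricZl, metricZr,
  bracketDl, bracketDr, bracketZl, bracketZr, vfDE, vfNE, vfZE, vfD, vfN, @vf_leibniz).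

Variable T : V -> V -> V -> C.
Hypothesis T3 : three_form_on (fun=> True) T.

Let TZl f X X' Y Z : T (f *: X + X') Y Z = f * T X Y Z + T X' Y Z.
Proof. by have [+ _ _] := T3; apply. Qed.
Let TC12 X Y Z : T X Y Z = - T Y X Z.
Proof. by have [_ + _] := T3; apply. Qed.
Let TC23 X Y Z : T X Y Z = - T X Z Y.
Proof. by have [_ _ +] := T3; apply. Qed.

Fact koszul_torsion_scalar X Y : scalar (fun Z => 2^-1 *: (koszul X Y Z + T X Y Z)).
Proof.
move=> f Z Z'; rewrite -sf_scaleAr -scalerDr; congr (_ *: _).
have -> : T X Y (f *: Z + Z') = f * T X Y Z + T X Y Z'.
  by rewrite TC23 TC12 TZl (TC12 Z) (TC12 Z') (TC23 X Z) (TC23 X Z'); ring.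
rewrite /koszul !metric_bracketE (metricC g Z X) (metricC g Z Y) (metricC g Z' X).
by ring.
Qed.

(** The connection is Levi-Civita plus half of [T], obtained at once by duality. Its axioms are
    compared after doubling, where no fraction is left. *)
Lemma exists_metric_connection : exists nabla,
  metric_connection g nabla /\ forall X Y Z, torsion g nabla X Y Z = T X Y Z.
Proof.
have /choice[n nP] : forall XY : V * V, exists A, forall Z,
    g A Z = 2^-1 *: (koszul XY.1 XY.2 Z + T XY.1 XY.2 Z).
  by move=> [X Y]; apply: exists_dual_field; exact: koszul_torsion_scalar.
pose nabla X Y := n (X, Y).
have gn X Y Z : g (nabla X Y) Z + g (nabla X Y) Z = koszul X Y Z + T X Y Z.
  have half2 : 2^-1 + 2^-1 = 1 :> R by field.
  by rewrite !nP /= -scalerDl half2 scale1r.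
exists nabla; split; [split; [split|]|].
- move=> Y f X X'; apply: (@metric_inj _ _ _ g) => Z; rewrite !metric_bracketE.
  apply: sf_dbl_inj; rewrite gn.
  have -> : f * g (nabla X Y) Z + g (nabla X' Y) Z + (f * g (nabla X Y) Z + g (nabla X' Y) Z) =
    f * (g (nabla X Y) Z + g (nabla X Y) Z) + (g (nabla X' Y) Z + g (nabla X' Y) Z) by ring.
  rewrite !gn TZl /koszul !metric_bracketE (metricC g Z X) (metricC g Z X').
  by ring.
- move=> X Y Y'; apply: (@metric_inj _ _ _ g) => Z; rewrite metricDl.
  apply: sf_dbl_inj; rewrite gn addrACA !gn /koszul !metric_bracketE.
  have -> : T X (Y + Y') Z = T X Y Z + T X Y' Z.
    have lin : scalar (fun W => T W X Z) by move=> a U U'; exact: TZl.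
    by rewrite TC12 (formD lin) (TC12 X Y) (TC12 X Y') opprD.
  by ring.
- move=> X f Y; apply: (@metric_inj _ _ _ g) => Z; rewrite metricDl !metricZl.
  apply: sf_dbl_inj; rewrite gn.
  have -> : X f * g Y Z + f * g (nabla X Y) Z + (X f * g Y Z + f * g (nabla X Y) Z) =
     X f * g Y Z + X f * g Y Z + f * (g (nabla X Y) Z + g (nabla X Y) Z) by ring.
  have -> : T X (f *: Y) Z = f * T X Y Z.
    have lin : scalar (fun W => T W X Z) by move=> a U U'; exact: TZl.
    by rewrite TC12 (formZ lin f Y) (TC12 X) mulrN.
  rewrite gn /koszul !metric_bracketE (metricC g Y X); ring.
- move=> X Y Z; apply: sf_dbl_inj.
  have -> : g (nabla X Y) Z + g Y (nabla X Z) + (g (nabla X Y) Z + g Y (nabla X Z)) =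
     (g (nabla X Y) Z + g (nabla X Y) Z) + (g (nabla X Z) Y + g (nabla X Z) Y).
     by rewrite (metricC g Y); ring.
  rewrite !gn /koszul (TC23 X Z Y) (metricC g Z Y) (metricC g Z X) (metricC g Y X).
  rewrite (bracketC Z Y) (bracketC X Z) (bracketC Y X) !metricNl.
  by ring.
- move=> X Y Z; rewrite /torsion; apply: sf_dbl_inj; rewrite !metric_bracketE.
  have -> : g (nabla X Y) Z - g (nabla Y X) Z - g (bracket X Y) Z +
      (g (nabla X Y) Z - g (nabla Y X) Z - g (bracket X Y) Z) =
     (g (nabla X Y) Z + g (nabla X Y) Z) - (g (nabla Y X) Z + g (nabla Y X) Z)
     - g (bracket X Y) Z - g (bracket X Y) Z by ring.
  rewrite !gn /koszul (TC12 Y X) (metricC g Z Y) (metricC g Z X) (metricC g Y X).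
  rewrite (bracketC Z Y) (bracketC X Z) (bracketC Y X) !metricNl.
  by ring.
Qed.
End Connections.

(** * Permutations of three indices *)

Lemma ord3_cases (P : 'I_3 -> Prop) : P 0 -> P 1 -> P 2%:R -> forall i, P i.
Proof.
move=> P0 P1 P2 [[|[|[|//]]] h].
- by rewrite (_ : Ordinal h = 0) //; exact: val_inj.
- by rewrite (_ : Ordinal h = 1) //; exact: val_inj.
- by rewrite (_ : Ordinal h = 2%:R) //; exact: val_inj.
Qed.

(** The translations [tr i] of the integers modulo 3 have cube [1], hence are even; any other
    permutation is a transposition composed with a translation. *)
Lemma odd_perm3 (s : 'S_3) : odd_perm s = (s 1 != s 0 + 1).
Proof.
pose tr i : 'S_3 := perm (addrI i).
have even_tr i : odd_perm (tr i) = false.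
  have : odd_perm (tr i * tr i * tr i)%g = false.
    rewrite (_ : (tr i * tr i * tr i)%g = 1%g) ?odd_perm1 //.
    apply/permP => x; rewrite !permM !permE.
    by apply/eqP; move: i x; do 2![apply: ord3_cases].
  by rewrite !odd_permM; case: (odd_perm _).
have perm_eq3 (u v : 'S_3) : u 0 = v 0 -> u 1 = v 1 -> u 2%:R = v 2%:R -> u = v.
  by move=> h0 h1 h2; apply/permP; exact: ord3_cases.
have s01 : s 0 != s 1 by rewrite (inj_eq perm_inj).
have s02 : s 0 != s 2%:R by rewrite (inj_eq perm_inj).
have s12 : s 1 != s 2%:R by rewrite (inj_eq perm_inj).
have [e|ne] := eqVneq (s 1) (s 0 + 1).
  have -> : s = tr (s 0); last exact: even_tr.
  have H (x z : 'I_3) : (x != z) && (x + 1 != z) ==> (z == x + 2%:R).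
    by move: x z; do 2![apply: ord3_cases].
  apply: perm_eq3; rewrite permE ?addr0 //.
  by apply/eqP; apply: (implyP (H _ _)); rewrite s02 -e s12.
have -> : s = (tperm (1%R : 'I_3) (2%:R)%R * tr (s 0))%g.
  2: by rewrite odd_permM odd_tperm even_tr.
apply: perm_eq3; rewrite permM permE.
- by rewrite tpermD // addr0.
- have H (x y : 'I_3) : [&& x != y & y != x + 1] ==> (y == x + 2%:R).
    by move: x y; do 2![apply: ord3_cases].
  by rewrite tpermL; apply/eqP; apply: (implyP (H _ _)); rewrite s01.
- have H (x y z : 'I_3) : [&& x != y, x != z, y != z & y != x + 1] ==> (z == x + 1).
    by move: x y z; do 3![apply: ord3_cases].
  by rewrite tpermR; apply/eqP; apply: (implyP (H (s 0) (s 1) _));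
    rewrite s01 s02 s12.
Qed.

Lemma even_tripleE i j k : even_triple i j k = (j == i + 1) && (k == i + 2%:R).
Proof.
apply/existsP/andP => [[s /and4P[]]|[/eqP-> /eqP->]].
  rewrite odd_perm3 negbK => /eqP e /eqP<- /eqP<- /eqP<-; rewrite e; split=> //.
  have s02 : s 0 != s 2%:R by rewrite (inj_eq perm_inj).
  have s12 : s 1 != s 2%:R by rewrite (inj_eq perm_inj).
  have H (x z : 'I_3) : (x != z) && (x + 1 != z) ==> (z == x + 2%:R).
    by move: x z; do 2![apply: ord3_cases].
  by apply: (implyP (H _ _)); rewrite s02 -e s12.
by exists (perm (addrI i)); rewrite odd_perm3 !permE addr0 !eqxx.
Qed.

Lemma odd_tripleE i j k : odd_triple i j k = (j == i + 2%:R) && (k == i + 1).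
Proof.
apply/existsP/andP => [[s /and4P[]]|[/eqP-> /eqP->]].
  rewrite odd_perm3 => ne /eqP<- /eqP<- /eqP<-.
  have s01 : s 0 != s 1 by rewrite (inj_eq perm_inj).
  have s02 : s 0 != s 2%:R by rewrite (inj_eq perm_inj).
  have s12 : s 1 != s 2%:R by rewrite (inj_eq perm_inj).
  have H (x y z : 'I_3) : [&& x != y, x != z, y != z & y != x + 1] ==>
      (y == x + 2%:R) && (z == x + 1).
    by move: x y z; do 3![apply: ord3_cases].
  by apply/andP; apply: (implyP (H _ _ _)); rewrite s01 s02 s12.
(* The odd permutations are the reflections sending [x] to [i - x]. *)
have inj : injective (fun x => i - x) by move=> x y /addrI/oppr_inj.
exists (perm inj); rewrite odd_perm3 !permE subr0 eqxx.
by move: i {inj}; apply: ord3_cases.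
Qed.

Lemma even_tripleS i : even_triple i (i + 1) (i + 2%:R).
Proof. by rewrite even_tripleE !eqxx. Qed.

Lemma even_triple_rot i j k : even_triple i j k -> even_triple j k i.
Proof.
rewrite !even_tripleE => /andP[/eqP-> /eqP->].
by move: i; apply: ord3_cases.
Qed.

Lemma sum_even_triple (V : nmodType) (F : 'I_3 -> V) i j k : even_triple i j k ->
  \sum_l F l = F i + F j + F k.
Proof.
rewrite even_tripleE => /andP[/eqP-> /eqP->].
rewrite (bigD1 i) //= (bigD1 (i + 1)) /=; last by move: i; apply: ord3_cases.
rewrite (bigD1 (i + 2%:R)) /=; last by move: i; apply: ord3_cases.
rewrite big1 ?addr0 ?addrA // => l.
by move: i l; do 2![apply: ord3_cases].
Qed.

Lemma even_triple_ind i j k (P : 'I_3 -> Prop) : even_triple i j k ->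
  P i -> P j -> P k -> forall l, P l.
Proof.
rewrite even_tripleE => /andP[/eqP-> /eqP->].
have H (x l : 'I_3) : [|| l == x, l == x + 1 | l == x + 2%:R].
  by move: x l; do 2![apply: ord3_cases].
by move=> Pi Pj Pk l; have /or3P[] := H i l => /eqP->.
Qed.

(** * Almost contact metric structures *)

Section LinearMap.
Variables (R : realType) (m : nat) (M : manifold R m).
Local Notation V := (vectorField M).
Variables (phi : V -> V) (lin : linear phi).

Lemma endoD X Y : phi (X + Y) = phi X + phi Y.
Proof. by have := lin 1 X Y; rewrite !scale1r. Qed.

Lemma endo0 : phi 0 = 0.
Proof. by have /(congr1 (fun f => f - phi 0)) := endoD 0 0;
  rewrite addr0 subrr addrK. Qed.

Lemma endoZ f X : phi (f *: X) = f *: phi X.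
Proof. by have := lin f X 0; rewrite endo0 !addr0. Qed.

Lemma endoN X : phi (- X) = - phi X.
Proof. by rewrite -scaleN1r endoZ scaleN1r. Qed.

End LinearMap.

Section ThreeForms.
Variables (R : realType) (m : nat) (M : manifold R m).
Local Notation C := (smoothFun M).
Local Notation V := (vectorField M).
Implicit Types (X Y Z : V) (P : V -> Prop) (T : V -> V -> V -> C).

Lemma three_form_onW P T : three_form_on (fun=> True) T -> three_form_on P T.
Proof. by case=> h1 h2 h3; split=> *; [apply: h1|apply: h2|apply: h3]. Qed.

Lemma three_form_onD P T T' : three_form_on P T -> three_form_on P T' ->
  three_form_on P (fun X Y Z => T X Y Z + T' X Y Z).
Proof.
move=> [a1 a2 a3] [b1 b2 b3]; split=> *.
- by rewrite a1 // b1 //; ring.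
- by rewrite a2 // b2 //; ring.
- by rewrite a3 // b3 //; ring.
Qed.

Lemma three_form_onN P T : three_form_on P T ->
  three_form_on P (fun X Y Z => - T X Y Z).
Proof.
move=> [a1 a2 a3]; split=> *.
- by rewrite a1 //; ring.
- by rewrite a2.
- by rewrite a3.
Qed.

Lemma three_form_comp T (phi : V -> V) : linear phi ->
  three_form_on (fun=> True) T ->
  three_form_on (fun=> True) (fun X Y Z => T (phi X) (phi Y) (phi Z)).
Proof.
move=> lin [h1 h2 h3]; split=> *; [|exact: h2|exact: h3].
by rewrite (endoD lin) (endoZ lin) h1.
Qed.

Lemma d2_three_form (Phi : V -> V -> C) : (forall X, scalar (Phi X)) ->
  (forall X Y, Phi X Y = - Phi Y X) -> three_form_on (fun=> True) (d2 Phi).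
Proof.
move=> lin sk.
have Dl X Y Z : Phi (X + Y) Z = Phi X Z + Phi Y Z.
  by rewrite sk (formD (lin Z)) opprD -!sk.
have Zl f X Y : Phi (f *: X) Y = f * Phi X Y.
  by rewrite sk (formZ (lin Y)) -mulrN -sk.
have Nl X Y : Phi (- X) Y = - Phi X Y by rewrite sk (formN (lin Y)) -sk.
have e := (Dl, Zl, Nl, fun X => formD (lin X), fun X => formZ (lin X), fun X => formN (lin X)).
split=> [f X X' Y Z _ _ _ _|X Y Z _ _ _|X Y Z _ _ _]; rewrite /d2.
- rewrite !(bracketDl, bracketDr, bracketZl, bracketZr) !e.
  by rewrite (sk Z X) (sk Z X') !(vfDE, vfZE, vfD, vfN, @vf_leibniz); ring.
- rewrite (bracketC Y X) (bracketC X Z) (bracketC Z Y) !Nl (sk Y X) (sk X Z) (sk Z Y) !vfN; ring.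
- rewrite (bracketC X Z) (bracketC Z Y) (bracketC Y X) !Nl (sk Y X) (sk X Z) (sk Z Y) !vfN; ring.
Qed.

End ThreeForms.

Section AlmostContact.
Variables (R : realType) (m : nat) (M : manifold R m) (g : riemannianMetric M).
Local Notation C := (smoothFun M).
Local Notation V := (vectorField M).
Implicit Types (X Y Z : V) (f : C).

Lemma sf_sqr_eq0 f : f * f = 0 -> f = 0.
Proof.
move=> ff; apply: sfP => p; have := congr1 (fun h : C => h p) ff.
by rewrite sfME => /eqP; rewrite mulf_eq0 orbb => /eqP.
Qed.

Variables (s : contactData M) (acm : almost_contact_metric g s).
Local Notation phi := (cd_phi s).
Local Notation xi := (cd_xi s).
Local Notation eta := (cd_eta s).

Lemma acm_phi : linear phi. Proof. by case: s acm => phi xi eta []. Qed.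
Lemma acm_eta : scalar eta. Proof. by case: s acm => phi xi eta []. Qed.
Lemma acm_phi2 X : phi (phi X) = - X + eta X *: xi.
Proof. by case: s acm => phi xi eta []. Qed.
Lemma acm_eta_xi : eta xi = 1. Proof. by case: s acm => phi xi eta []. Qed.
Lemma acm_metric X Y : g (phi X) (phi Y) = g X Y - eta X * eta Y.
Proof. by case: s acm => phi xi eta []. Qed.

(** Computing [phi^3 xi] in two ways gives [phi xi = f xi] with [f = eta (phi xi)]; then
    [0 = phi^2 xi = f^2 xi]. The ring of functions has zero divisors but no nilpotents, so
    [f = 0]. *)
Lemma acm_phi_xi : phi xi = 0.
Proof.
have e1 : phi (phi xi) = 0 by rewrite acm_phi2 acm_eta_xi scale1r addNr.
have e2 : phi xi = eta (phi xi) *: xi.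
  have := acm_phi2 (phi xi); rewrite e1 (endo0 acm_phi) => /eqP.
  by rewrite eq_sym addrC subr_eq0 => /eqP.
suff : eta (phi xi) = 0 by move=> e; rewrite e2 e scale0r.
apply: sf_sqr_eq0.
have := congr1 eta e1; rewrite e2 (endoZ acm_phi) {2}e2 !(formZ acm_eta) acm_eta_xi (form0 acm_eta).
by rewrite mulr1.
Qed.

Lemma acm_etaE X : eta X = g X xi.
Proof.
have := acm_metric X xi; rewrite acm_phi_xi metric0r acm_eta_xi mulr1 => /eqP.
by rewrite eq_sym subr_eq0 => /eqP.
Qed.

Lemma acm_eta_phi X : eta (phi X) = 0.
Proof.
have := acm_phi2 (phi X); rewrite (acm_phi2 X) (endoD acm_phi) (endoN acm_phi) (endoZ acm_phi).
rewrite acm_phi_xi scaler0 addr0 => /eqP;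
  rewrite eq_sym addrC -subr_eq0 opprK addrNK => /eqP e.
by have := congr1 eta e; rewrite (formZ acm_eta) acm_eta_xi (form0 acm_eta) mulr1.
Qed.

Lemma acm_skew X Y : g (phi X) Y = - g X (phi Y).
Proof.
have := acm_metric (phi X) Y; rewrite acm_eta_phi mul0r subr0 => <-.
rewrite acm_phi2 metricDl metricNl metricZl -[g xi _]metricC -acm_etaE acm_eta_phi.
by rewrite mulr0 addr0.
Qed.

End AlmostContact.

(** * Connections with skew torsion and the derivative of an almost contact structure *)

Section SkewTorsionConnection.
Variables (R : realType) (m : nat) (M : manifold R m) (g : riemannianMetric M).
Local Notation C := (smoothFun M).
Local Notation V := (vectorField M).
Implicit Types (X Y Z : V) (f : C).
Variables (nabla : V -> V -> V).
Hypotheses (mc : metric_connection g nabla) (st : skew_torsion g nabla).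
Local Notation T := (torsion g nabla).

Lemma conn_metric X Y Z : X (g Y Z) = g (nabla X Y) Z + g Y (nabla X Z).
Proof. by have [_] := mc; apply. Qed.
Lemma connDr X Y Y' : nabla X (Y + Y') = nabla X Y + nabla X Y'.
Proof. by have [[_ + _] _] := mc; apply. Qed.
Lemma connZr X f Y : nabla X (f *: Y) = X f *: Y + f *: nabla X Y.
Proof. by have [[_ _ +] _] := mc; apply. Qed.
Lemma conn0r X : nabla X 0 = 0.
Proof. by have := connZr X 0 0; rewrite !scale0r scaler0 addr0. Qed.
Lemma connNr X Y : nabla X (- Y) = - nabla X Y.
Proof. by rewrite -scaleN1r connZr vfN vf1 oppr0 scale0r add0r scaleN1r. Qed.
Lemma conn_linear Y : linear (nabla^~ Y).
Proof. by have [[+ _ _] _] := mc; apply. Qed.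
Lemma connDl X X' Y : nabla (X + X') Y = nabla X Y + nabla X' Y.
Proof. exact: (endoD (conn_linear Y)). Qed.
Lemma connZl X f Y : nabla (f *: X) Y = f *: nabla X Y.
Proof. exact: (endoZ (conn_linear Y)). Qed.

Lemma torsionC12 X Y Z : T X Y Z = - T Y X Z.
Proof. by have [_ + _] := st; apply. Qed.
Lemma torsionC23 X Y Z : T X Y Z = - T X Z Y.
Proof. by have [_ _ +] := st; apply. Qed.
Lemma torsion_rot X Y Z : T X Y Z = T Y Z X.
Proof. by rewrite torsionC12 torsionC23 opprK. Qed.
Lemma torsionXX X Z : T X X Z = 0.
Proof. by apply: sf_dbl_inj; rewrite {1}torsionC12 addNr addr0. Qed.

Lemma metric_bracket X Y Z :
  g (bracket X Y) Z = g (nabla X Y) Z - g (nabla Y X) Z - T X Y Z.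
Proof. by rewrite /torsion !(metricDl, metricNl); ring. Qed.

Lemma d1_torsion (eta : V -> C) (xi : V) X Y : (forall Z, eta Z = g Z xi) ->
  d1 eta X Y = T X Y xi + g Y (nabla X xi) - g X (nabla Y xi).
Proof. by move=> e; rewrite /d1 !e !conn_metric metric_bracket; ring. Qed.

(** The torsion terms [T(xi, X, Y)] and [T(xi, Y, X)] cancel in the Lie derivative of [g], so
    Killing's equation reads as it does for the Levi-Civita connection. *)
Lemma Killing_conn xi :
  Killing g xi <-> forall X Y, g (nabla X xi) Y = - g X (nabla Y xi).
Proof.
have E X Y : g (bracket xi X) Y + g X (bracket xi Y) =
    xi (g X Y) - (g (nabla X xi) Y + g X (nabla Y xi)).
  rewrite [g X (bracket _ _)]metricC !metric_bracket conn_metric (torsionC23 xi Y X).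
  by rewrite (metricC g (nabla xi Y)) (metricC g (nabla Y xi)); ring.
split=> [K X Y|sk X Y]; last by rewrite E sk addNr subr0.
apply/eqP; rewrite -addr_eq0; apply/eqP.
have := E X Y; rewrite -(K X Y) => /eqP;
  rewrite eq_sym subr_eq addrC -subr_eq subrr eq_sym.
by move/eqP.
Qed.

Section Structure.
Variables (s : contactData M) (acm : almost_contact_metric g s).
Local Notation phi := (cd_phi s).
Local Notation xi := (cd_xi s).
Local Notation eta := (cd_eta s).
Local Notation F X Y := (nabla_endo nabla X phi Y).

Lemma nabla_endoDr X Y Y' : F X (Y + Y') = F X Y + F X Y'.
Proof. by rewrite /nabla_endo !(connDr, endoD (acm_phi acm)) opprD addrACA. Qed.

Lemma nabla_endoZr X f Y : F X (f *: Y) = f *: F X Y.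
Proof.
rewrite /nabla_endo !(connZr, endoD (acm_phi acm), endoZ (acm_phi acm)).
by rewrite opprD addrACA subrr add0r scalerBr.
Qed.

Lemma nabla_endo_linear X : linear (nabla_endo nabla X phi).
Proof. by move=> f Y Y'; rewrite nabla_endoDr nabla_endoZr. Qed.

Lemma nabla_endo_linearl Y : linear (fun X => nabla_endo nabla X phi Y).
Proof.
move=> f X X'; rewrite /nabla_endo connDl connZl connDl connZl.
by rewrite (endoD (acm_phi acm)) (endoZ (acm_phi acm)) scalerBr opprD addrACA.
Qed.

Lemma nabla_endo_skew X Y Z : g (F X Y) Z = - g Y (F X Z).
Proof.
rewrite /nabla_endo !metric_bracketE [g (phi _) _](acm_skew acm).
have E := conn_metric X (phi Y) Z; have E' := conn_metric X Y (phi Z).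
have : g (nabla X (phi Y)) Z + g (phi Y) (nabla X Z) +
   (g (nabla X Y) (phi Z) + g Y (nabla X (phi Z))) = 0.
  by rewrite -E -E' (acm_skew acm) vfN addNr.
rewrite (acm_skew acm Y (nabla X Z)) => e.
apply/eqP; rewrite -subr_eq0; apply/eqP; rewrite -[RHS]e; ring.
Qed.

Lemma NijenhuisE X Y : Nijenhuis s X Y =
  bracket (phi X) (phi Y) + phi (phi (bracket X Y))
  - phi (bracket (phi X) Y) - phi (bracket X (phi Y)) + d1 eta X Y *: xi.
Proof. by rewrite /Nijenhuis; case: s. Qed.

Lemma Nijenhuis_minus_dPhi_torsion X Y Z : eta X = 0 -> eta Y = 0 -> eta Z = 0 ->
  Nijenhuis_minus_dPhi g s X Y Z =
  T X Y Z + g (F X Y) (phi Z) - g (F Y X) (phi Z) - g (F (phi Z) X) Y.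
Proof.
move=> eX eY eZ.
have p2 W : eta W = 0 -> phi (phi W) = - W.
  by move=> e; rewrite (acm_phi2 acm) e scale0r addr0.
have [[pX pY] pZ] := (p2 X eX, p2 Y eY, p2 Z eZ).
have skB A B W : g (phi (bracket A B)) W = - g (bracket A B) (phi W).
  exact: acm_skew.
have skC A B W : g (phi (nabla A B)) W = - g (nabla A B) (phi W).
  exact: acm_skew.
(* [e1] and [e3] differentiate the relation [g(phi A, B) + g(A, phi B) = 0] along [phi X] and
   [phi Z]. Once brackets are replaced by [nabla] and [T], the difference of the two sides is a
   combination of these two. *)
have e1 : g (nabla (phi X) (phi Y)) Z + g (phi Y) (nabla (phi X) Z) +
    (g (nabla (phi X) Y) (phi Z) + g Y (nabla (phi X) (phi Z))) = 0.
  by rewrite -!conn_metric (acm_skew acm) vfN addNr.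
have e3 : g (nabla (phi Z) (phi Y)) X + g (phi Y) (nabla (phi Z) X) +
    (g (nabla (phi Z) Y) (phi X) + g Y (nabla (phi Z) (phi X))) = 0.
  by rewrite -!conn_metric (acm_skew acm) vfN addNr.
rewrite /Nijenhuis_minus_dPhi NijenhuisE /d2 /fundamental_form pX pY pZ.
rewrite !metric_bracketE (acm_skew acm (phi (bracket X Y))) !skB pZ !metric_bracketE.
rewrite [g xi Z]metricC -(acm_etaE acm) eZ mulr0 addr0.
rewrite !skC pZ !metricNr !metric_bracket !conn_metric.
rewrite -(torsion_rot X (phi Y)) (torsion_rot (phi Z) (phi X)).
apply/eqP; rewrite -subr_eq0; apply/eqP.
rewrite -[RHS](addr0 0) -{1}e1 -e3.
have cN W A B : g W (nabla A B) = g (nabla A B) W by exact: metricC.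
by rewrite !cN; ring.
Qed.

End Structure.
End SkewTorsionConnection.

(** * Almost 3-contact metric structures *)

Section AlmostThreeContact.
Variables (R : realType) (m : nat) (M : manifold R m) (g : riemannianMetric M).
Local Notation C := (smoothFun M).
Local Notation V := (vectorField M).
Implicit Types (X Y Z W : V) (f : C).
Variables (S : 'I_3 -> contactData M) (hS : almost_3_contact_metric g S).
Local Notation phi i := (cd_phi (S i)).
Local Notation xi i := (cd_xi (S i)).
Local Notation eta i := (cd_eta (S i)).

Lemma a3_acm i : almost_contact_metric g (S i).
Proof. by have [+ _] := hS; apply. Qed.

Section Triple.
Variables (i j k : 'I_3) (E : even_triple i j k).

Lemma a3_phi_ij X : phi i (phi j X) = phi k X + eta j X *: xi i.
Proof. by have [_ /(_ _ _ _ E)[-> _ _ _]] := hS; rewrite subrK. Qed.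
Lemma a3_phi_ji X : phi j (phi i X) = - phi k X + eta i X *: xi j.
Proof. by have [_ /(_ _ _ _ E)[_ -> _ _]] := hS; rewrite opprD opprK addrNK. Qed.
Lemma a3_phi_xi_ij : phi i (xi j) = xi k.
Proof. by have [_ /(_ _ _ _ E)[_ _ [-> _] _]] := hS. Qed.
Lemma a3_phi_xi_ji : phi j (xi i) = - xi k.
Proof. by have [_ /(_ _ _ _ E)[_ _ [_ ->] _]] := hS; rewrite opprK. Qed.
Lemma a3_eta_phi_ij X : eta i (phi j X) = eta k X.
Proof. by have [_ /(_ _ _ _ E)[_ _ _ /(_ X)[-> _]]] := hS. Qed.
Lemma a3_eta_phi_ji X : eta j (phi i X) = - eta k X.
Proof. by have [_ /(_ _ _ _ E)[_ _ _ /(_ X)[_ ->]]] := hS; rewrite opprK. Qed.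
Lemma a3_eta_xi_ik : eta i (xi k) = 0.
Proof. by rewrite -a3_phi_xi_ij (acm_eta_phi (a3_acm i)). Qed.
Lemma a3_eta_xi_jk : eta j (xi k) = 0.
Proof.
by rewrite -[xi k]opprK -a3_phi_xi_ji (formN (acm_eta (a3_acm j))) (acm_eta_phi (a3_acm j)) oppr0.
Qed.

End Triple.

Lemma a3_eta_xi i l : eta i (xi l) = (i == l)%:R.
Proof.
have E := even_tripleS l.
apply: (even_triple_ind E (P := fun i => eta i (xi l) = (i == l)%:R)).
- by rewrite eqxx (acm_eta_xi (a3_acm l)).
- rewrite (a3_eta_xi_ik (even_triple_rot E)).
  by rewrite (_ : (l + 1 == l) = false) //; move: l {E}; apply: ord3_cases.
- rewrite (a3_eta_xi_jk (even_triple_rot E)).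
  by rewrite (_ : (l + 2%:R == l) = false) //; move: l {E}; apply: ord3_cases.
Qed.

Lemma a3_etaE i X : eta i X = g X (xi i).
Proof. exact: acm_etaE (a3_acm i) X. Qed.

Lemma a3_metric_xi i l : g (xi i) (xi l) = (i == l)%:R.
Proof. by rewrite metricC -a3_etaE a3_eta_xi. Qed.

Lemma horizontal_metric X i : horizontal S X -> g X (xi i) = 0.
Proof. by move=> hX; rewrite -a3_etaE. Qed.

Lemma horizontal_phi i X : horizontal S X -> horizontal S (phi i X).
Proof.
move=> hX; have E := even_tripleS i; have E' := even_triple_rot (even_triple_rot E).
apply: (even_triple_ind E (P := fun l => eta l (phi i X) = 0)).
- exact: acm_eta_phi (a3_acm i) X.
- by rewrite (a3_eta_phi_ji E) hX oppr0.
- by rewrite (a3_eta_phi_ij E') hX.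
Qed.

Lemma horizontalD X Y : horizontal S X -> horizontal S Y -> horizontal S (X + Y).
Proof. by move=> hX hY i; rewrite (formD (acm_eta (a3_acm i))) hX hY addr0. Qed.

Lemma horizontalZ f X : horizontal S X -> horizontal S (f *: X).
Proof. by move=> hX i; rewrite (formZ (acm_eta (a3_acm i))) hX mulr0. Qed.

Definition hproj X := X - \sum_i eta i X *: xi i.

Lemma horizontal_hproj X : horizontal S (hproj X).
Proof.
move=> l; have lin := acm_eta (a3_acm l).
rewrite /hproj (formB lin) (form_sum lin) (bigD1 l) //= big1 ?addr0 => [|i il].
  by rewrite (formZ lin) a3_eta_xi eqxx mulr1 subrr.
by rewrite (formZ lin) a3_eta_xi eq_sym (negbTE il) mulr0.
Qed.

Lemma hprojE X : X = hproj X + \sum_i eta i X *: xi i.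
Proof. by rewrite subrK. Qed.

Lemma hproj_id X : horizontal S X -> hproj X = X.
Proof. by move=> hX; rewrite /hproj big1 ?subr0 // => i _; rewrite hX scale0r. Qed.

Lemma hproj_linear : linear hproj.
Proof.
move=> f X Y; rewrite /hproj scalerBr addrACA -opprD; congr (_ - _).
rewrite scaler_sumr -big_split; apply: eq_bigr => i _ /=.
by rewrite (acm_eta (a3_acm i)) scalerDl scalerA.
Qed.

Lemma hproj_xi l : hproj (xi l) = 0.
Proof.
rewrite /hproj (bigD1 l) //= a3_eta_xi eqxx scale1r big1 ?addr0 ?subrr // => i il.
by rewrite a3_eta_xi (negbTE il) scale0r.
Qed.

Lemma form_split (alpha : V -> C) : scalar alpha ->
  (forall Z, horizontal S Z -> alpha Z = 0) -> (forall l, alpha (xi l) = 0) ->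
  forall Z, alpha Z = 0.
Proof.
move=> lin h v Z; rewrite (hprojE Z) (formD lin) (form_sum lin) h ?add0r;
  last exact: horizontal_hproj.
by apply: big1 => i _; rewrite (formZ lin) v mulr0.
Qed.

Lemma endo_split (F : V -> V) : linear F ->
  (forall Z, horizontal S Z -> F Z = 0) -> (forall l, F (xi l) = 0) ->
  forall Z, F Z = 0.
Proof.
move=> lin h v Z; rewrite (hprojE Z) (endoD lin) h ?add0r;
  last exact: horizontal_hproj.
rewrite (big_morph F (endoD lin) (endo0 lin)).
by apply: big1 => i _; rewrite (endoZ lin) v scaler0.
Qed.

Lemma metric_split W : (forall Z, horizontal S Z -> g W Z = 0) ->
  (forall l, g W (xi l) = 0) -> W = 0.
Proof.
move=> h v; apply: (@metric_inj _ _ _ g) => Z; rewrite metric0l.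
by apply: form_split Z => //; exact: metric_linear.
Qed.

Definition rotates_xi (nabla : V -> V -> V) (b : C) : Prop :=
  forall i j k, even_triple i j k -> forall X,
    nabla X (xi i) = b *: (eta k X *: xi j - eta j X *: xi k).

Lemma canonical_rotates_xi nabla b : canonical_connection g S nabla b ->
  rotates_xi nabla b.
Proof.
move=> cc i j k E X; have [mc _ _] := cc; have E' := even_triple_rot E;
  have E'' := even_triple_rot E'.
have aci := a3_acm i.
have [_ _ /(_ _ _ _ E X (xi i))] := cc.
rewrite /nabla_endo (acm_phi_xi aci) (conn0r mc) sub0r (a3_phi_xi_ji E) (a3_phi_xi_ij E'').
move=> e.
(* [xi i] has constant length, so its derivative is orthogonal to it; there [phi i] is inverted by
   [- phi i]. *)
have n0 : eta i (nabla X (xi i)) = 0.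
  rewrite (a3_etaE i); apply: sf_dbl_inj; rewrite addr0 {2}metricC -(conn_metric mc).
  by rewrite a3_metric_xi eqxx vf1.
have := acm_phi2 aci (nabla X (xi i)); rewrite n0 scale0r addr0 => e2.
rewrite -[LHS]opprK -e2 -(endoN (acm_phi aci)) e.
rewrite !(endoZ (acm_phi aci), endoD (acm_phi aci), endoN (acm_phi aci)).
rewrite (a3_phi_xi_ij E) (a3_phi_xi_ji E'') .
by congr (_ *: _); rewrite !scalerN opprK.
Qed.

Section RotatedXi.
Variables (nabla : V -> V -> V) (b : C).
Hypotheses (mc : metric_connection g nabla) (st : skew_torsion g nabla).
Hypothesis conn_xi : rotates_xi nabla b.
Local Notation T := (torsion g nabla).

Lemma conn_xi_horizontal X i : horizontal S X -> nabla X (xi i) = 0.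
Proof. by move=> hX; rewrite (conn_xi (even_tripleS i)) !hX !scale0r subrr scaler0. Qed.

Lemma metric_conn_xi i j k X Y : even_triple i j k ->
  g (nabla X (xi i)) Y = b * (eta k X * eta j Y - eta j X * eta k Y).
Proof.
move=> E; rewrite (conn_xi E) metricZl metricDl metricNl !metricZl.
by rewrite ![g (xi _) _]metricC -!a3_etaE.
Qed.

Lemma horizontal_conn X Y : horizontal S Y -> horizontal S (nabla X Y).
Proof.
move=> hY i; rewrite a3_etaE; have := conn_metric mc X Y (xi i).
rewrite (horizontal_metric i hY) vf0 [g Y _]metricC (metric_conn_xi X Y (even_tripleS i)).
by rewrite !hY !mulr0 subrr mulr0 addr0.
Qed.

Lemma vertical_conn X Y : vertical S Y -> vertical S (nabla X Y).
Proof.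
case=> f ->; have /choice[g' gE] : forall i, exists h : 'I_3 -> C,
    nabla X (xi i) = \sum_l h l *: xi l.
  move=> i; have E := even_tripleS i; set j := i + 1 in E; set k := i + 2%:R in E.
  exists (fun l => b * (eta k X * (l == j)%:R - eta j X * (l == k)%:R)).
  rewrite (conn_xi E) (sum_even_triple _ E) !eqxx.
  have -> : (i == j) = false by rewrite /j; move: i {E j k}; apply: ord3_cases.
  have -> : (i == k) = false by rewrite /k; move: i {E j k}; apply: ord3_cases.
  have -> : (j == k) = false by rewrite /j /k; move: i {E j k}; apply: ord3_cases.
  have -> : (k == j) = false by rewrite /j /k; move: i {E j k}; apply: ord3_cases.
  rewrite /= !mulr0n !mulr1n.
  by apply: vfP => h; rewrite !(vfDE, vfZE, vfNE); ring.
exists (fun l => X (f l) + \sum_i f i * g' i l).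
have -> : nabla X (\sum_i f i *: xi i) = \sum_i nabla X (f i *: xi i).
  by rewrite (big_morph (nabla X) (connDr mc X) (conn0r mc X)).
transitivity (\sum_i X (f i) *: xi i + \sum_i \sum_l (f i * g' i l) *: xi l).
  rewrite -big_split; apply: eq_bigr => i _ /=; rewrite (connZr mc) gE scaler_sumr.
  by congr (_ + _); apply: eq_bigr => l _; rewrite scalerA.
rewrite exchange_big -big_split; apply: eq_bigr => l _ /=.
by rewrite scalerDl scaler_suml.
Qed.

(** The coefficient is [b + b] because [nabla xi_i] is skew, so that both terms of [d1_torsion]
    contribute equally. *)
Lemma torsion_xi i j k X Y : even_triple i j k ->
  T X Y (xi i) = d1 (eta i) X Y + (b + b) * (eta j X * eta k Y - eta k X * eta j Y).
Proof.
move=> E; rewrite (d1_torsion mc X Y (a3_etaE i)) [g Y _]metricC [g X _]metricC.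
by rewrite !(metric_conn_xi _ _ E); ring.
Qed.

Lemma torsion_xi_horizontal i X Y : horizontal S X ->
  T X Y (xi i) = d1 (eta i) X Y.
Proof. by move=> hX; rewrite (torsion_xi X Y (even_tripleS i)) !hX !mul0r subrr mulr0 addr0. Qed.

Lemma xi_Killing i : Killing g (xi i).
Proof.
apply/(Killing_conn mc st) => X Y; rewrite [g X _]metricC.
by rewrite !(metric_conn_xi _ _ (even_tripleS i)); ring.
Qed.

End RotatedXi.

End AlmostThreeContact.

(** * The associated sphere and the Reeb Killing function *)

Section SphereAndUniqueness.
Variables (R : realType) (m : nat) (M : manifold R m) (g : riemannianMetric M).
Local Notation C := (smoothFun M).
Local Notation V := (vectorField M).
Implicit Types (X Y Z W : V) (f : C).
Variables (S : 'I_3 -> contactData M) (hS : almost_3_contact_metric g S).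
Local Notation phi i := (cd_phi (S i)).
Local Notation xi i := (cd_xi (S i)).
Local Notation eta i := (cd_eta (S i)).

(** Expanding the brackets produces [- T(xi_j, phi_i X, Y) - T(xi_j, X, phi_i Y)], which the two
    [d eta_j] terms of [A_form] cancel. Only properties of [xi j] are assumed, so the lemma applies
    before [nabla] is known to rotate the [phi i]. *)
Lemma A_form_conn nabla i j X Y : metric_connection g nabla -> skew_torsion g nabla ->
  (forall X, horizontal S X -> nabla X (xi j) = 0) ->
  (forall X Y, horizontal S X -> horizontal S Y ->
     torsion g nabla X Y (xi j) = d1 (eta j) X Y) ->
  horizontal S X -> horizontal S Y ->
  A_form g S i j X Y = g (nabla_endo nabla (xi j) (phi i) X) Y.
Proof.
move=> mc st n0 tE hX hY; have aci := a3_acm hS i.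
have hpX := horizontal_phi hS i hX; have hpY := horizontal_phi hS i hY.
rewrite /A_form /nabla_endo -!tE // !(metricDl, metricNl) !(acm_skew aci).
rewrite !(metric_bracket g nabla) !n0 // !metric0l.
by rewrite !(torsion_rot st (xi j)); ring.
Qed.

(** The [phi i] anticommute up to terms in the [eta i] and [xi i], so the cross terms of the square
    assemble into [et X *: x], and the diagonal gives [- X] because the squares sum to [1]. *)
Lemma combination_acm (a : 'I_3 -> R) : \sum_i a i ^+ 2 = 1 ->
  almost_contact_metric g (combination S a).
Proof.
move=> a1; pose c i := a i *: (1 : C).
have cE i f : a i *: f = c i * f by rewrite -sf_scaleAl mul1r.
have E := even_tripleS 0; set i := 0 : 'I_3 in E; set j := 0 + 1 in E;
  set k := 0 + 2%:R in E.
have E' := even_triple_rot E; have E'' := even_triple_rot E'.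
have c1 : c i * c i + c j * c j + c k * c k = 1.
  rewrite -(sum_even_triple (fun i => c i * c i) E) -[RHS]scale1r -a1 scaler_suml.
  by apply: eq_bigr => l _; rewrite expr2 -scalerA -cE.
pose ph X := c i *: phi i X + c j *: phi j X + c k *: phi k X.
pose x := c i *: xi i + c j *: xi j + c k *: xi k.
pose et X := c i * eta i X + c j * eta j X + c k * eta k X.
have -> : combination S a = ContactData ph x et.
  rewrite /combination; congr ContactData.
  - by apply/funext => X; rewrite (sum_even_triple _ E).
  - by rewrite (sum_even_triple _ E).
  - by apply/funext => X; rewrite (sum_even_triple _ E) !cE.
have lp l := acm_phi (a3_acm hS l); have le l := acm_eta (a3_acm hS l).
have ph2 X : ph (ph X) = - X + et X *: x.
  rewrite -[X in - X]scale1r -c1 /ph.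
  rewrite !(endoD (lp _)) !(endoZ (lp _)) !(acm_phi2 (a3_acm hS _)).
  rewrite !(a3_phi_ij hS E, a3_phi_ij hS E', a3_phi_ij hS E'').
  rewrite !(a3_phi_ji hS E, a3_phi_ji hS E', a3_phi_ji hS E'').
  by apply: vfP => f; rewrite !(vfDE, vfNE, vfZE) /et; ring.
split=> //.
- by move=> f X Y; rewrite /ph !lp; apply: vfP => h; rewrite !(vfDE, vfNE, vfZE);
    ring.
- by move=> f X Y; rewrite /et !le; ring.
- rewrite /et /x !(formD (le _)) !(formZ (le _)) !(a3_eta_xi hS) !eqxx.
  have -> : (i == j) = false by []. have -> : (i == k) = false by [].
  have -> : (j == k) = false by []. have -> : (j == i) = false by [].
  have -> : (k == i) = false by []. have -> : (k == j) = false by [].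
  by rewrite !mulr0n !mulr1n -[RHS]c1; ring.
- have sk X Y : g (ph X) Y = - g X (ph Y).
    rewrite /ph !(metricDl, metricDr, metricZl, metricZr) !(acm_skew (a3_acm hS _)).
    by ring.
  move=> X Y; rewrite sk ph2 metricDr metricNr metricZr /x !metricDr !metricZr.
  by rewrite -!(a3_etaE hS) /et; ring.
Qed.

Lemma combination_phi_horizontal a X : horizontal S X ->
  horizontal S (cd_phi (combination S a) X).
Proof.
move=> hX l; rewrite /= (form_sum (acm_eta (a3_acm hS l))) big1 // => i _.
by rewrite (formZ (acm_eta (a3_acm hS l))) (horizontal_phi hS i hX) mulr0.
Qed.

Lemma combination_eta_horizontal a X : horizontal S X -> cd_eta (combination S a) X = 0.
Proof. by move=> hX; rewrite /= big1 // => i _; rewrite hX scaler0. Qed.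

(** Take [X] horizontal and nonzero at [p], and [Y = phi_k X]: then the fundamental form equals
    [- g(X, X)], which can be cancelled at [p]. *)
Lemma Reeb_Killing_function_unique b b' : (3 < m)%N ->
  Reeb_Killing_function g S b -> Reeb_Killing_function g S b' -> b = b'.
Proof.
move=> m3 hb hb'; apply: sfP => p.
have [W [W0 [f Wf]]] := exists_common_kernel p m3 (fun j => acm_eta (a3_acm hS j)).
pose X := hproj S W; have hX : horizontal S X := horizontal_hproj hS W.
(* Projecting does not change the field at [p], since the [eta i] of [W] vanish there. *)
have Xf : X f p != 0.
  rewrite /X /hproj vfDE vfNE vf_sumE sfDE sfNE sf_sumE big1 ?subr0 // => i _.
  by rewrite vfZE sfME W0 mul0r.
have E := even_tripleS 0; have hY := horizontal_phi hS (0 + 2%:R) hX.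
have [_ /(_ _ _ _ E)[_ e]] := hb _ _ hX hY.
have [_ /(_ _ _ _ E)[_ e']] := hb' _ _ hX hY.
have := congr1 (fun h : C => h p) (etrans (esym e) e').
rewrite /fundamental_form (acm_phi2 (a3_acm hS _)) hX scale0r addr0 metricNr.
rewrite !sfME sfNE => /mulIf; apply.
by rewrite oppr_eq0 gt_eqF // metric_pos //; exists f.
Qed.

End SphereAndUniqueness.

(** * Consequences of the existence of the connection *)

Lemma epsilon_even (R : realType) i j k : even_triple i j k -> epsilon R i j k = 1.
Proof. by rewrite /epsilon => ->. Qed.

Lemma epsilon_odd (R : realType) i j k : even_triple j i k -> epsilon R i j k = -1.
Proof.
rewrite /epsilon odd_tripleE !even_tripleE => E.
have -> : (j == i + 1) && (k == i + 2%:R) = false.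
  by apply: contraTF E; move: i j k; do 3![apply: ord3_cases].
suff -> : (j == i + 2%:R) && (k == i + 1) by [].
by move: E; apply/implyP; move: i j k; do 3![apply: ord3_cases].
Qed.

Lemma epsilon_repeat (R : realType) i j k : (i == j) || (j == k) || (i == k) ->
  epsilon R i j k = 0.
Proof.
rewrite /epsilon odd_tripleE even_tripleE => E.
have -> : (j == i + 1) && (k == i + 2%:R) = false.
  by apply: contraTF E; move: i j k; do 3![apply: ord3_cases].
suff -> : (j == i + 2%:R) && (k == i + 1) = false by [].
by apply: contraTF E; move: i j k; do 3![apply: ord3_cases].
Qed.

Section CanonicalConnections.
Variables (R : realType) (m : nat) (M : manifold R m) (g : riemannianMetric M).
Local Notation C := (smoothFun M).
Local Notation V := (vectorField M).
Implicit Types (X Y Z W : V) (f : C).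
Variables (S : 'I_3 -> contactData M) (hS : almost_3_contact_metric g S).
Local Notation phi i := (cd_phi (S i)).
Local Notation xi i := (cd_xi (S i)).
Local Notation eta i := (cd_eta (S i)).

Lemma koszul_metric_connection nabla X Y Z : metric_connection g nabla ->
  skew_torsion g nabla ->
  g (nabla X Y) Z + g (nabla X Y) Z = koszul g X Y Z + torsion g nabla X Y Z.
Proof.
move=> mc st; rewrite /koszul !(conn_metric mc) !(metric_bracket g nabla).
have cN A B W : g W (nabla A B) = g (nabla A B) W by exact: metricC.
rewrite !cN (torsion_rot st Y Z X) (torsion_rot st Z X Y); ring.
Qed.

Section Consequences.
Variables (nabla : V -> V -> V) (b : C).
Hypothesis cc : canonical_connection g S nabla b.
Local Notation T := (torsion g nabla).

Let mc : metric_connection g nabla. Proof. by have [] := cc. Qed.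
Let st : skew_torsion g nabla. Proof. by have [] := cc. Qed.
Let rx : rotates_xi S nabla b. Proof. exact (canonical_rotates_xi hS cc). Qed.

Lemma nabla_phi_horizontal i X Y : horizontal S X -> nabla_endo nabla X (phi i) Y = 0.
Proof.
move=> hX; have [_ _ /(_ _ _ _ (even_tripleS i) X Y)->] := cc.
by rewrite !hX !scale0r subrr scaler0.
Qed.

(** The coefficients of a point of the sphere are constants, so [nabla X] does not differentiate
    them. *)
Lemma nabla_combination_horizontal a X Y : horizontal S X ->
  nabla_endo nabla X (cd_phi (combination S a)) Y = 0.
Proof.
move=> hX; rewrite /nabla_endo /=.
rewrite (big_morph (nabla X) (connDr mc X) (conn0r mc X)) -sumrB big1 // => i _.
rewrite (connZr mc) vf_cst scale0r add0r -scalerBr.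
by have := nabla_phi_horizontal i Y hX; rewrite /nabla_endo => ->; rewrite scaler0.
Qed.

Lemma torsion_horizontal a X Y Z : \sum_i a i ^+ 2 = 1 ->
  horizontal S X -> horizontal S Y -> horizontal S Z ->
  T X Y Z = Nijenhuis_minus_dPhi g (combination S a) X Y Z.
Proof.
move=> a1 hX hY hZ; have acm := combination_acm hS a1.
rewrite (Nijenhuis_minus_dPhi_torsion mc st acm) ?combination_eta_horizontal //.
have hpZ := combination_phi_horizontal hS a hZ.
by rewrite !nabla_combination_horizontal // !metric0l !subr0 addr0.
Qed.

Lemma torsion_horizontal_i i X Y Z :
  horizontal S X -> horizontal S Y -> horizontal S Z ->
  T X Y Z = Nijenhuis_minus_dPhi g (S i) X Y Z.
Proof.
move=> hX hY hZ.
rewrite (Nijenhuis_minus_dPhi_torsion mc st (a3_acm hS i)) //.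
have hpZ := horizontal_phi hS i hZ.
by rewrite !nabla_phi_horizontal // !metric0l !subr0 addr0.
Qed.

Lemma canonical_connection_Reeb_Killing : Reeb_Killing_function g S b.
Proof.
move=> X Y hX hY.
have A i j : A_form g S i j X Y = g (nabla_endo nabla (xi j) (phi i) X) Y.
  apply: A_form_conn => //; first by move=> Z hZ; exact: (conn_xi_horizontal rx).
  by move=> Z W hZ hW; exact: (torsion_xi_horizontal hS mc rx).
have rot i j k : even_triple i j k -> forall Z W, nabla_endo nabla Z (phi i) W =
    b *: (eta k Z *: phi j W - eta j Z *: phi k W) by have [_ _ +] := cc; apply.
split=> [i|i j k E].
  rewrite A (rot _ _ _ (even_tripleS i)) !(a3_eta_xi hS).
  have -> : (i + 1 == i) = false by move: i; apply: ord3_cases.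
  have -> : (i + 2%:R == i) = false by move: i; apply: ord3_cases.
  by rewrite !mulr0n !scale0r subrr scaler0 metric0l.
have E' := even_triple_rot E.
(* Along [xi j] the derivative of [phi i] is [- b phi_k], and along [xi i] that of [phi j] is
   [b phi_k]; the signs flip because [g(phi_k X, Y)] is minus the fundamental form. *)
rewrite !A (rot _ _ _ E) (rot _ _ _ E') !(a3_eta_xi hS) !eqxx.
move: (E); rewrite even_tripleE => /andP[/eqP ej /eqP ek].
have -> : (k == j) = false by rewrite ek ej; move: i {E E' ej ek}; apply: ord3_cases.
have -> : (k == i) = false by rewrite ek; move: i {E E' ej ek}; apply: ord3_cases.
rewrite !mulr0n !mulr1n !scale0r !scale1r add0r subr0 !metricZl.
by rewrite /fundamental_form (acm_skew (a3_acm hS k)); split; ring.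
Qed.

Lemma canonical_of_connection : canonical g S.
Proof.
split.
- move=> i; have aci := a3_acm hS i.
  have d3 : three_form_on (fun=> True) (d2 (fundamental_form g (S i))).
    apply: d2_three_form => [X f Y Z|X Y]; rewrite /fundamental_form.
      by rewrite (acm_phi aci) metric_linear.
    by rewrite -(acm_skew aci) metricC.
  (* On horizontal fields the Nijenhuis tensor is the torsion plus the pullback of [d Phi] by
     [phi i], a sum of two 3-forms. *)
  have [h1 h2 h3] := three_form_onD st (three_form_comp (acm_phi aci) d3).
  have e X Y Z : horizontal S X -> horizontal S Y -> horizontal S Z ->
      g (Nijenhuis (S i) X Y) Z =
      T X Y Z + d2 (fundamental_form g (S i)) (phi i X) (phi i Y) (phi i Z).
    by move=> hX hY hZ; rewrite (torsion_horizontal_i i hX hY hZ) subrK.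
  split=> [f X X' Y Z hX hX' hY hZ|X Y Z hX hY hZ|X Y Z hX hY hZ].
  + rewrite !e // ?h1 //.
    by apply: (horizontalD hS) => //; exact: (horizontalZ hS).
  + by rewrite !e // h2.
  + by rewrite !e // h3.
- by move=> i; exact: (xi_Killing hS mc st rx).
- by move=> i j X Y Z hX hY hZ; rewrite -!torsion_horizontal_i.
- by exists b; exact: canonical_connection_Reeb_Killing.
Qed.

Lemma canonical_connection_phi_compatible s : associated_sphere S s ->
  phi_compatible g S s nabla.
Proof.
case=> a [a1 ->]; split=> //.
- by move=> X Y hY; exact: (horizontal_conn hS mc rx).
- by move=> X Y hY; exact: (vertical_conn mc rx).
- by move=> X Y hX _; exact: nabla_combination_horizontal.
Qed.

Lemma torsion_horizontal_xi_xi X i j : horizontal S X ->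
  T X (xi i) (xi j) = - g (bracket (xi i) (xi j)) X.
Proof.
move=> hX; rewrite (torsion_rot st) (metric_bracket g nabla).
have n0 l l' : g (nabla (xi l) (xi l')) X = 0.
  by rewrite (metric_conn_xi hS rx _ _ (even_tripleS l')) !hX !mulr0 subrr mulr0.
by rewrite !n0 subrr sub0r opprK.
Qed.

Lemma eta_bracket_xi i j k : even_triple i j k ->
  eta k (bracket (xi i) (xi j)) = b + b - T (xi i) (xi j) (xi k).
Proof.
move=> E; have E' := even_triple_rot E.
rewrite (a3_etaE hS) (metric_bracket g nabla) (metric_conn_xi hS rx _ _ E).
rewrite (metric_conn_xi hS rx _ _ E') !(a3_eta_xi hS) !eqxx.
move: (E); rewrite even_tripleE => /andP[/eqP ej /eqP ek].
have -> : (k == i) = false by rewrite ek; move: i {E E' ej ek}; apply: ord3_cases.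
have -> : (k == j) = false by rewrite ek ej; move: i {E E' ej ek}; apply: ord3_cases.
rewrite !mulr0n !mulr1n; ring.
Qed.

Lemma eta_bracket_xi_repeat i j : eta i (bracket (xi i) (xi j)) = 0.
Proof.
have Ei := even_tripleS i; have Ej := even_tripleS j.
rewrite (a3_etaE hS) (metric_bracket g nabla) (torsionC23 st) (torsionXX st).
rewrite (metric_conn_xi hS rx _ _ Ei) (metric_conn_xi hS rx _ _ Ej) !(a3_eta_xi hS).
by move: i j {Ei Ej}; do 2![apply: ord3_cases]; rewrite /=; ring.
Qed.

Lemma Reeb_commutator_exists : exists delta, Reeb_commutator_function S delta.
Proof.
(* Forced by [2 delta = 2 b - T(xi_1, xi_2, xi_3)], which is [eta_bracket_xi]. *)
exists (b - 2^-1 *: T (xi 0) (xi 1) (xi 2%:R)).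
have two (f : C) : (2 : R) *: f = f + f by rewrite scaler_nat mulr2n.
have ev i j k : even_triple i j k -> eta k (bracket (xi i) (xi j)) =
    (2 : R) *: (b - 2^-1 *: T (xi 0) (xi 1) (xi 2%:R)).
  move=> E; rewrite (eta_bracket_xi E) scalerBr two scalerA mulfV ?pnatr_eq0 // scale1r.
  congr (_ - _); move: E; rewrite even_tripleE => /andP[/eqP-> /eqP->].
  move: i; apply: ord3_cases; rewrite ?add0r //.
  - by rewrite -(torsion_rot st); congr (T _ _ _); congr (xi _); exact: val_inj.
  - by rewrite (torsion_rot st); congr (T _ _ _); congr (xi _); exact: val_inj.
move=> i j k; have [E|nE] := boolP (even_triple i j k).
  by rewrite epsilon_even // mulr1; exact: ev.
have [E|nE'] := boolP (even_triple j i k).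
  rewrite epsilon_odd // mulrN1 scaleNr -(ev _ _ _ E) [in LHS]bracketC.
  exact: (formN (acm_eta (a3_acm hS k))).
have rep : (i == j) || (j == k) || (i == k).
  move: nE nE'; rewrite !even_tripleE; move=> h h'; move: h h'.
  by move=> h; apply/implyP; move: h; apply/implyP; move: i j k;
    do 3![apply: ord3_cases].
rewrite epsilon_repeat // mulr0 scale0r.
move: rep => /orP[/orP[]|] /eqP e.
- by rewrite e bracketXX (form0 (acm_eta (a3_acm hS k))).
- by rewrite -e bracketC (formN (acm_eta (a3_acm hS j))) eta_bracket_xi_repeat oppr0.
- by rewrite -e eta_bracket_xi_repeat.
Qed.

Lemma torsion_xi_xi_xi delta : Reeb_commutator_function S delta ->
  T (xi 0) (xi 1) (xi 2%:R) = 2 *: (b - delta).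
Proof.
have E := even_tripleS 0; rewrite !add0r in E.
move=> /(_ 0 1 2%:R); rewrite (eta_bracket_xi E) epsilon_even // mulr1 => e.
rewrite scalerBr -e scaler_nat mulr2n; ring.
Qed.

End Consequences.

(** The functions agree first, by uniqueness of the Reeb Killing function; then the torsions agree,
    and Koszul's formula recovers the connections. *)
Lemma canonical_connection_unique nabla b nabla' b' : (3 < m)%N ->
  canonical_connection g S nabla b -> canonical_connection g S nabla' b' ->
  nabla' = nabla.
Proof.
move=> m3 cc cc'.
have eb : b' = b.
  exact: (Reeb_Killing_function_unique hS m3 (canonical_connection_Reeb_Killing cc')
    (canonical_connection_Reeb_Killing cc)).
have [[mc st _] [mc' st' _]] := (cc, cc'); rewrite {}eb in cc'.
have [rx rx'] := (canonical_rotates_xi hS cc, canonical_rotates_xi hS cc').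
have lin nab X Y : skew_torsion g nab -> scalar (torsion g nab X Y).
  by move=> st1 f Z Z'; rewrite /torsion metric_linear.
pose D X Y Z := torsion g nabla' X Y Z - torsion g nabla X Y Z.
have D12 X Y Z : D X Y Z = - D Y X Z.
  by rewrite /D (torsionC12 st) (torsionC12 st'); ring.
have D23 X Y Z : D X Y Z = - D X Z Y.
  by rewrite /D (torsionC23 st) (torsionC23 st'); ring.
have Dlin X Y : scalar (D X Y).
  by move=> f Z Z'; rewrite /D !lin //; ring.
have Dxi X Y i : D X Y (xi i) = 0.
  by rewrite /D (torsion_xi hS mc rx _ _ (even_tripleS i)) (torsion_xi hS mc' rx' _ _
    (even_tripleS i)) subrr.
have Drot X Y Z : D X Y Z = D Y Z X by rewrite D12 D23 opprK.
(* The difference [D] is skew and vanishes if its last argument is a [xi i]; the horizontality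
   assumptions are removed one slot at a time by moving that slot to the end. *)
have D3 X Y Z : horizontal S X -> horizontal S Y -> D X Y Z = 0.
  move=> hX hY; apply: (form_split hS (Dlin X Y)) => [{}Z hZ|l]; last exact: Dxi.
  by rewrite /D (torsion_horizontal_i cc' 0) // (torsion_horizontal_i cc 0) // subrr.
have D2 X Y Z : horizontal S X -> D X Y Z = 0.
  move=> hX; rewrite D23 -[RHS]oppr0; congr (- _).
  apply: (form_split hS (Dlin X Z)) => [{}Y hY|l]; last exact: Dxi.
  by rewrite D23 D3 ?oppr0.
have D0 X Y Z : D X Y Z = 0.
  rewrite Drot; apply: (form_split hS (Dlin Y Z)) => [{}X hX|l]; last exact: Dxi.
  by rewrite -Drot D2.
apply/funext => X; apply/funext => Y; apply: (@metric_inj _ _ _ g) => Z.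
apply: sf_dbl_inj; rewrite !koszul_metric_connection //; congr (_ + _).
by apply/eqP; rewrite -subr_eq0; apply/eqP; exact: D0.
Qed.

End CanonicalConnections.

(** * Existence of the connection *)

Section Existence.
Variables (R : realType) (m : nat) (M : manifold R m) (g : riemannianMetric M).
Local Notation C := (smoothFun M).
Local Notation V := (vectorField M).
Implicit Types (X Y Z W : V) (f : C).
Variables (S : 'I_3 -> contactData M) (hS : almost_3_contact_metric g S).
Local Notation phi i := (cd_phi (S i)).
Local Notation xi i := (cd_xi (S i)).
Local Notation eta i := (cd_eta (S i)).
Local Notation h := (hproj S).

(** * Gluing a horizontal 3-form with prescribed values on the Reeb fields *)

Section Extension.
Variables (tau : V -> V -> V -> C) (theta : 'I_3 -> V -> V -> C).
Hypothesis tau3 : three_form_on (horizontal S) tau.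
Hypothesis theta_lin : forall i X, scalar (theta i X).
Hypothesis theta_skew : forall i X Y, theta i X Y = - theta i Y X.
Hypothesis theta_xi : forall i l X, theta i X (xi l) = - theta l X (xi i).

(* Obtained by splitting off the vertical part of [X], then of [Y], then of [Z]. *)
Definition form_extension X Y Z : C := tau (h X) (h Y) (h Z) +
  \sum_i (eta i X * theta i Y Z + eta i Y * theta i Z (h X) + eta i Z * theta i (h X) (h Y)).

Let hh X : horizontal S (h X). Proof. exact: (horizontal_hproj hS). Qed.

Let theta_linl i Y : scalar (fun X => theta i X Y).
Proof. by move=> f X X'; rewrite !(theta_skew _ _ Y) theta_lin; ring. Qed.

Let theta_split i X Z :
  theta i X Z - theta i (h X) Z = \sum_l eta l X * theta i (xi l) Z.
Proof.
have lin := theta_linl i Z.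
rewrite {1}(hprojE S X) (formD lin) (form_sum lin) addrC addKr.
by apply: eq_bigr => l _; rewrite (formZ lin).
Qed.

(** Both sides are double sums of [eta_i(X) eta_l(Y) theta_i(xi_l, Z)], and [theta_xi] with skewness
    makes [theta_i(xi_l, Z)] skew in [i] and [l]. *)
Let theta_exchange X Y Z :
  \sum_i eta i X * (theta i Y Z - theta i (h Y) Z) =
  - \sum_i eta i Y * (theta i X Z - theta i (h X) Z).
Proof.
under eq_bigr => i _ do rewrite theta_split mulr_sumr.
rewrite exchange_big -sumrN; apply: eq_bigr => l _ /=.
rewrite theta_split mulr_sumr -sumrN; apply: eq_bigr => i _.
by rewrite theta_skew theta_xi (theta_skew l _ Z); ring.
Qed.

(** The formula treats its arguments unequally. Its failure to be visibly skew is repaired by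
    [theta_exchange X Y Z] for the first two slots and by [theta_exchange Y Z (h X)] for the last
    two. *)
Lemma form_extension_three_form : three_form_on (fun=> True) form_extension.
Proof.
have [t1 t2 t3] := tau3; rewrite /form_extension.
split=> [f X X' Y Z _ _ _ _|X Y Z _ _ _|X Y Z _ _ _].
- rewrite (hproj_linear hS) t1 // mulrDr addrACA; congr (_ + _).
  rewrite mulr_sumr -big_split; apply: eq_bigr => i _ /=.
  rewrite (acm_eta (a3_acm hS i)) theta_lin.
  by rewrite (theta_linl i (h Y) f (h X) (h X')); ring.
- rewrite t2 // opprD; congr (_ + _); apply/eqP; rewrite -addr_eq0; apply/eqP.
  rewrite -big_split /=; have := theta_exchange X Y Z.
  move/eqP; rewrite -addr_eq0 -big_split /= => /eqP e0; rewrite -[RHS]e0;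
    apply: eq_bigr => i _.
  rewrite (theta_skew i Z (h X)) (theta_skew i Z (h Y)) (theta_skew i (h Y) (h X));
    ring.
- rewrite t3 // opprD; congr (_ + _); apply/eqP; rewrite -addr_eq0; apply/eqP.
  rewrite -big_split /=; have := theta_exchange Y Z (h X).
  move/eqP; rewrite -addr_eq0 -big_split /= => /eqP e0; rewrite -[RHS]e0;
    apply: eq_bigr => i _.
  rewrite (theta_skew i Z Y) (theta_skew i (h X) (h Y)) (theta_skew i (h X) (h Z));
    ring.
Qed.

Lemma form_extension_horizontal X Y Z : horizontal S X -> horizontal S Y ->
  horizontal S Z -> form_extension X Y Z = tau X Y Z.
Proof.
move=> hX hY hZ; rewrite /form_extension !hproj_id // big1 ?addr0 // => i _.
by rewrite hX hY hZ; ring.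
Qed.

(** With [Z = xi_i] the three groups of terms are [theta_i(X, Y) - theta_i(hX, Y)],
    [theta_i(hX, Y) - theta_i(hX, hY)] and [theta_i(hX, hY)], and they telescope. *)
Lemma form_extension_xi X Y i : form_extension X Y (xi i) = theta i X Y.
Proof.
have [t1 t2 t3] := tau3.
have h0 : horizontal S 0 by rewrite -(hproj_xi hS 0); exact: hh.
have tau0 : tau (h X) (h Y) 0 = 0.
  rewrite t3 // t2 // opprK.
  by have := t1 (-1) 0 0 (h X) (h Y) h0 h0 (hh _) (hh _);
    rewrite scaler0 addr0 mulN1r addNr.
rewrite /form_extension (hproj_xi hS) tau0 add0r.
transitivity (\sum_l (eta l X * theta i (xi l) Y) +
    \sum_l (- (eta l Y * theta i (xi l) (h X))) + theta i (h X) (h Y)).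
  rewrite !big_split /=; congr (_ + _ + _).
  - by apply: eq_bigr => l _; rewrite theta_xi (theta_skew i _ Y).
  - by apply: eq_bigr => l _; rewrite (theta_skew l) theta_xi (theta_skew i (h X));
      ring.
  - rewrite (bigD1 i) //= big1 ?addr0 => [|l li];
      rewrite (a3_eta_xi hS) ?eqxx ?mul1r //.
    by rewrite (negbTE li) mul0r.
rewrite sumrN -!theta_split (theta_skew i Y) (theta_skew i (h Y)); ring.
Qed.

End Extension.

Lemma d1_scalar (al : V -> C) X : scalar al -> scalar (d1 al X).
Proof.
move=> lin f Y Y'; rewrite /d1 lin !(vfD, @vf_leibniz, vfDE, vfZE).
by rewrite bracketDr bracketZr !(formD lin) !(formZ lin); ring.
Qed.

Lemma d1_skew (al : V -> C) X Y : scalar al -> d1 al X Y = - d1 al Y X.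
Proof. by move=> lin; rewrite /d1 bracketC (formN lin); ring. Qed.

Lemma even_triple_neq i j k : even_triple i j k ->
  ((i == j) = false) * ((j == k) = false) * ((i == k) = false) *
  ((j == i) = false) * ((k == j) = false) * ((k == i) = false).
Proof.
rewrite even_tripleE => /andP[/eqP-> /eqP->].
by do !split; move: i; apply: ord3_cases.
Qed.

(** * The connection of a canonical manifold *)

Section CanonicalConnection.
Variables (b : C).
Hypotheses (can : canonical g S) (RK : Reeb_Killing_function g S b).

Let K i : Killing g (xi i). Proof. by have [_ + _ _] := can. Qed.

(** The values of [T(X, Y, xi_i)] forced by [torsion_xi], with the even triple written out so that
    they depend on [i] alone. *)
Let theta i X Y := d1 (eta i) X Y +
  (b + b) * (eta (i + 1) X * eta (i + 2%:R) Y - eta (i + 2%:R) X * eta (i + 1) Y).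

Let thetaE i j k X Y : even_triple i j k ->
  theta i X Y = d1 (eta i) X Y + (b + b) * (eta j X * eta k Y - eta k X * eta j Y).
Proof. by rewrite even_tripleE => /andP[/eqP-> /eqP->]. Qed.

(** Since [eta_p(xi_q)] is constant, Killing's equation gives [d eta_p(X, xi_q) = - g(X,
    [xi_q, xi_p])], which is skew in [p] and [q]. The [b] terms are skew on their own. *)
Let theta_xi i l X : theta i X (xi l) = - theta l X (xi i).
Proof.
have dxi p q : d1 (eta p) X (xi q) = - g X (bracket (xi q) (xi p)).
  rewrite /d1 (a3_eta_xi hS) [bracket X _]bracketC (formN (acm_eta (a3_acm hS p))).
  have -> : X (p == q)%:R = 0 by case: (p == q); rewrite ?vf1 ?vf0.
  by rewrite !(a3_etaE hS) K; ring.
have E := even_tripleS i; have E' := even_triple_rot E;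
  have E'' := even_triple_rot E'.
have skew : d1 (eta i) X (xi l) = - d1 (eta l) X (xi i).
  by rewrite !dxi (bracketC (xi l)) metricNr; ring.
rewrite (thetaE _ _ E) skew.
apply: (even_triple_ind E (P := fun l => - d1 (eta l) X (xi i) +
  (b + b) * (eta (i + 1) X * eta (i + 2%:R) (xi l) - eta (i + 2%:R) X * eta (i + 1) (xi l)) =
  - theta l X (xi i))).
- by rewrite (thetaE _ _ E) !(a3_eta_xi hS) !(even_triple_neq E) /= !(mulr0n, mulr1n); ring.
- by rewrite (thetaE _ _ E') !(a3_eta_xi hS) !eqxx !(even_triple_neq E) /= !(mulr0n, mulr1n); ring.
- by rewrite (thetaE _ _ E'') !(a3_eta_xi hS) !eqxx !(even_triple_neq E) /= !(mulr0n, mulr1n); ring.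
Qed.

(** By the third condition of [canonical], any of the three structures gives the same values on
    horizontal fields; [Nhor] below relies on this. *)
Let tau := Nijenhuis_minus_dPhi g (S 0).

Let tau3 : three_form_on (horizontal S) tau.
Proof.
have aci := a3_acm hS 0; have [N3 _ _ _] := can.
apply: (three_form_onD (N3 0)); apply: three_form_onN; apply: three_form_onW.
apply: (three_form_comp (acm_phi aci)); apply: d2_three_form => [X f Y Z|X Y].
  by rewrite /fundamental_form (acm_phi aci) metric_linear.
by rewrite /fundamental_form -(acm_skew aci) metricC.
Qed.

Lemma exists_rotating_connection : exists nabla, canonical_connection g S nabla b.
Proof.
have theta_lin i X : scalar (theta i X).
  move=> f Y Y'; rewrite /theta (d1_scalar X (acm_eta (a3_acm hS i))).
  by rewrite !(acm_eta (a3_acm hS _)); ring.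
have theta_skew i X Y : theta i X Y = - theta i Y X.
  by rewrite /theta (d1_skew X Y (acm_eta (a3_acm hS i))); ring.
have T3 := form_extension_three_form tau3 theta_lin theta_skew theta_xi.
have [nabla [mc TE]] := exists_metric_connection g T3.
have TE' : torsion g nabla = form_extension tau theta.
  by apply/funext => X; apply/funext => Y; apply/funext => Z.
have st : skew_torsion g nabla by rewrite /skew_torsion TE'.
have Txi i X Y : torsion g nabla X Y (xi i) = theta i X Y.
  by rewrite TE (form_extension_xi tau3).
(* As [xi i] is Killing, [nabla xi_i] is skew, so [d1_torsion] expresses twice [g(nabla_X xi_i, Y)]
   as [d eta_i - theta_i], and only the [b] term remains. *)
have rx : rotates_xi S nabla b.
  move=> i j k E X; apply: (@metric_inj _ _ _ g) => Y; apply: sf_dbl_inj.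
  have sk := (Killing_conn mc st (xi i)).1 (K i) X Y.
  have := d1_torsion mc X Y (a3_etaE hS i).
  rewrite Txi (thetaE _ _ E) [g Y _]metricC => e.
  have -> : g (nabla X (xi i)) Y + g (nabla X (xi i)) Y =
      g (nabla X (xi i)) Y - g X (nabla Y (xi i)) by rewrite {2}sk.
  have -> : g (nabla X (xi i)) Y - g X (nabla Y (xi i)) =
      (b + b) * (eta k X * eta j Y - eta j X * eta k Y).
    apply/eqP; rewrite -subr_eq0; apply/eqP.
    have := congr1 (fun u => u - d1 (eta i) X Y) e; rewrite subrr => e'.
    by rewrite -[RHS]oppr0 -[in RHS]oppr0 e'; ring.
  rewrite !(metricZl, metricDl, metricNl) ![g (xi _) Y]metricC -!(a3_etaE hS); ring.
exists nabla; split=> //.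
have Nhor i X Y Z : horizontal S X -> horizontal S Y -> horizontal S Z ->
    torsion g nabla X Y Z = Nijenhuis_minus_dPhi g (S i) X Y Z.
  move=> hX hY hZ; rewrite TE form_extension_horizontal //.
  by have [_ _ + _] := can; apply.
(* With [a], [b], [c] the cyclic permutations of the tensor, the identity reads
   [c = a + b]; permuting it gives [a = b + c], hence [b = 0]. *)
have hhh i X Y Z : horizontal S X -> horizontal S Y -> horizontal S Z ->
    g (nabla_endo nabla X (phi i) Y) Z = 0.
  have aci := a3_acm hS i.
  pose G X Y Z := g (nabla_endo nabla X (phi i) Y) Z.
  have cyc A B D : horizontal S A -> horizontal S B -> horizontal S D ->
      G D A B = G A B D + G B D A.
    move=> hA hB hD; have hpD := horizontal_phi hS i hD.
    have := Nijenhuis_minus_dPhi_torsion mc st aci (hA i) (hB i) (hpD i).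
    rewrite -Nhor // (acm_phi2 aci) hD scale0r addr0.
    rewrite (endoN (nabla_endo_linearl mc aci A)) metricNl !metricNr.
    rewrite (nabla_endo_skew mc aci B A D) [g A _]metricC => e.
    have := congr1 (fun u => u - torsion g nabla A B (phi i D)) e;
      rewrite subrr => e'.
    apply/eqP; rewrite -subr_eq0; apply/eqP;
      rewrite -[RHS]oppr0 -[in RHS]oppr0 e' /G; ring.
  move=> hX hY hZ; rewrite -[LHS]/(G X Y Z).
  have e1 : G X Y Z = G Z X Y - G Y Z X by rewrite (cyc X Y Z) // addrK.
  have e2 : G X Y Z = G Y Z X - G Z X Y by rewrite (cyc Z X Y) //; ring.
  by apply: sf_dbl_inj; rewrite {1}e1 e2; ring.
have hh i X Y : horizontal S X -> horizontal S Y -> nabla_endo nabla X (phi i) Y = 0.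
  move=> hX hY; apply: (metric_split hS) => [Z hZ|l]; first exact: hhh.
  rewrite -(a3_etaE hS) /nabla_endo (formB (acm_eta (a3_acm hS l))).
  rewrite (horizontal_phi hS i (horizontal_conn hS mc rx X hY)).
  by rewrite (horizontal_conn hS mc rx X (horizontal_phi hS i hY)) subrr.
move=> i j k E X Y; have E' := even_triple_rot E; have E'' := even_triple_rot E'.
have aci := a3_acm hS i.
pose rhs X Y := b *: (eta k X *: phi j Y - eta j X *: phi k Y).
(* [D] is tensorial in both arguments, so it may be tested on horizontal fields and on the [xi l]:
   [rx] handles [Y = xi_l], [hh] the purely horizontal case, and the Reeb Killing function the case
   of [X = xi_l] with [Y] horizontal. *)
pose D X Y := nabla_endo nabla X (phi i) Y - rhs X Y.
have Dlinr U : linear (D U).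
  move=> f Z Z'; rewrite /D /rhs (nabla_endo_linear mc aci) !(acm_phi (a3_acm hS _)).
  by apply: vfP => u; rewrite !(vfDE, vfNE, vfZE, vf0E); ring.
have Dlinl Z : linear (D^~ Z).
  move=> f U U'; rewrite /D /rhs (nabla_endo_linearl mc aci) !(acm_eta (a3_acm hS _)).
  by apply: vfP => u; rewrite !(vfDE, vfNE, vfZE, vf0E); ring.
suff : D X Y = 0 by move/eqP; rewrite subr_eq0 => /eqP.
apply: (endo_split hS (Dlinr X)) => [{}Y hY|l]; last first.
  have lp := acm_phi aci.
  apply: (even_triple_ind E (P := fun l => D X (xi l) = 0));
    rewrite /D /rhs /nabla_endo.
  - rewrite (acm_phi_xi aci) (conn0r mc) (rx _ _ _ E).
    rewrite !(endoZ lp, endoD lp, endoN lp) (a3_phi_xi_ij hS E) (a3_phi_xi_ji hS E'').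
    rewrite (a3_phi_xi_ji hS E) (a3_phi_xi_ij hS E'').
    by apply: vfP => u; rewrite !(vfDE, vfNE, vfZE, vf0E); ring.
  - rewrite (a3_phi_xi_ij hS E) (rx _ _ _ E'') (rx _ _ _ E').
    rewrite !(endoZ lp, endoD lp, endoN lp) (acm_phi_xi aci) (acm_phi_xi (a3_acm hS j)).
    rewrite (a3_phi_xi_ji hS E'') (a3_phi_xi_ji hS E').
    by apply: vfP => u; rewrite !(vfDE, vfNE, vfZE, vf0E); ring.
  - rewrite (a3_phi_xi_ji hS E'') (connNr mc) (rx _ _ _ E'') (rx _ _ _ E').
    rewrite !(endoZ lp, endoD lp, endoN lp) (acm_phi_xi aci) (acm_phi_xi (a3_acm hS k)).
    rewrite (a3_phi_xi_ij hS E) (a3_phi_xi_ij hS E').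
    by apply: vfP => u; rewrite !(vfDE, vfNE, vfZE, vf0E); ring.
apply: (endo_split hS (Dlinl Y)) => [{}X hX|l].
  by rewrite /D /rhs hh // !hX !scale0r subrr scaler0 subrr.
apply: (metric_split hS) => [Z hZ|l']; last first.
  rewrite -(a3_etaE hS) /D /rhs /nabla_endo.
  have le := acm_eta (a3_acm hS l').
  rewrite !(formD le, formN le, formZ le) !(horizontal_phi hS _ hY).
  rewrite (horizontal_conn hS mc rx _ (horizontal_phi hS i hY)).
  rewrite (horizontal_phi hS i (horizontal_conn hS mc rx _ hY)); ring.
have A p : g (nabla_endo nabla (xi p) (phi i) Y) Z = A_form g S i p Y Z.
  apply/esym/A_form_conn => //; first by move=> U hU; exact: (conn_xi_horizontal rx).
  by move=> U W hU hW; exact: (torsion_xi_horizontal hS mc rx).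
rewrite /D metricDl metricNl A /rhs metricZl metricDl metricNl !metricZl.
have [A0 A1] := RK hY hZ; have [_ A2] := A1 _ _ _ E; have [A3 A4] := A1 _ _ _ E''.
(* The pair [i, k] is in odd order; its value comes from the even triple [k, i, j] and the
   antisymmetry of [A_form] in its indices. *)
have A5 : A_form g S i k Y Z = - (b * fundamental_form g (S j) Y Z).
  by rewrite -A4 A3 opprK.
rewrite !(acm_skew (a3_acm hS _)) -![g Y (phi _ Z)]/(fundamental_form _ _ _ _).
apply: (even_triple_ind E (P := fun l => A_form g S i l Y Z -
   b * (eta k (xi l) * - fundamental_form g (S j) Y Z -
   eta j (xi l) * - fundamental_form g (S k) Y Z) = 0)).
- by rewrite A0 !(a3_eta_xi hS) !(even_triple_neq E) /= !mulr0n; ring.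
- by rewrite A2 !(a3_eta_xi hS) eqxx !(even_triple_neq E) /= !(mulr0n, mulr1n); ring.
- by rewrite A5 !(a3_eta_xi hS) eqxx !(even_triple_neq E) /= !(mulr0n, mulr1n); ring.
Qed.

End CanonicalConnection.
End Existence.

Theorem theorem4p1p1 (R : realType) (n : nat) (M : manifold R (4 * n + 3)%N)
    (g : riemannianMetric M) (S : 'I_3 -> contactData M)
    (hS : almost_3_contact_metric g S) :
  ((exists nabla : vectorField M -> vectorField M -> vectorField M,
    exists betat : smoothFun M, canonical_connection g S nabla betat)
   <-> canonical g S) /\
  (forall (nabla : vectorField M -> vectorField M -> vectorField M)
          (betat : smoothFun M),
    canonical_connection g S nabla betat ->
    [/\ (0 < n)%N ->
          forall nabla' betat', canonical_connection g S nabla' betat' ->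
            nabla' = nabla,
        forall s, associated_sphere S s -> phi_compatible g S s nabla,
        Reeb_Killing_function g S betat /\
        ((0 < n)%N -> forall beta, Reeb_Killing_function g S beta ->
           betat = beta),
        (forall X Y Z : vectorField M,
           horizontal S X -> horizontal S Y -> horizontal S Z ->
           [/\ forall s, associated_sphere S s ->
                 torsion g nabla X Y Z = Nijenhuis_minus_dPhi g s X Y Z,
               forall i, torsion g nabla X Y (cd_xi (S i)) =
                         d1 (cd_eta (S i)) X Y
             & forall i j, torsion g nabla X (cd_xi (S i)) (cd_xi (S j)) =
                           - g (bracket (cd_xi (S i)) (cd_xi (S j))) X])
      & (exists delta, Reeb_commutator_function S delta) /\
        (forall delta, Reeb_commutator_function S delta ->
           torsion g nabla (cd_xi (S 0)) (cd_xi (S 1)) (cd_xi (S 2%:R)) =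
           2 *: (betat - delta))]).
Proof.
split.
  split=> [[nabla [b cc]]|can]; first exact: (canonical_of_connection hS cc).
  have [_ _ _ [b RK]] := can.
  by have [nabla cc] := exists_rotating_connection hS can RK; exists nabla, b.
move=> nabla b cc.
(* A positive [n] leaves room for a direction outside the three Reeb fields. *)
have dim n0 : (0 < n0)%N -> (3 < 4 * n0 + 3)%N.
  move=> n0_gt0.
  by apply: leq_trans (leq_add (leq_pmulr 4 n0_gt0) (leqnn 3)).
have [mc st _] := cc; have rx := canonical_rotates_xi hS cc.
have RK := canonical_connection_Reeb_Killing hS cc.
split.
- by move=> /dim n3 nabla' b' cc'; exact: (canonical_connection_unique hS n3 cc cc').
- by move=> s sS; exact: (canonical_connection_phi_compatible hS cc sS).
- by split=> // /dim n3 beta RK'; exact: (Reeb_Killing_function_unique hS n3 RK RK').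
- move=> X Y Z hX hY hZ; split.
  + by move=> s [a [a1 ->]]; exact: (torsion_horizontal hS cc a1 hX hY hZ).
  + by move=> i; exact: (torsion_xi_horizontal hS mc rx i Y hX).
  + by move=> i j; exact: (torsion_horizontal_xi_xi hS cc i j hX).
- split; first exact: (Reeb_commutator_exists hS cc).
  by move=> delta hdelta; exact: (torsion_xi_xi_xi hS cc hdelta).
Qed.
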